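(* Let $\{\xi_k\}$ be an irreducible and aperiodic Markov chain on a finite state space $\Xi$ with stationary distribution $\pi$, and let $C>0$ be its geometric mixing constant (see context). Let $f(x)=\mathbb{E}_{\xi\sim\pi}[F(x;\xi)]$ on $\mathbb{R}^d$ be a (possibly nonconvex) function, with sample gradients $G(x;\xi)$ of $F(\cdot;\xi)$ at $x$. Assume: (i) $f^*:=\inf_{x\in\mathbb{R}^d} f(x)>-\infty$; (ii) there is $L>0$ such that $\|\nabla f(x)-\nabla f(y)\|\le L\|x-y\|$ and $\|G(x;\xi)-G(y;\xi)\|\le L\|x-y\|$ for all $x,y\in\mathbb{R}^d$ and all $\xi\in\Xi$; (iii) there is $M>0$ such that $\max\{\|\nabla f(x)\|,\|G(x;\xi)\|\}\le M$ for all $x\in\mathbb{R}^d$ and all $\xi\in\Xi$. Let $K>0$ be an integer with $\frac{1}{\sqrt K}\le\frac{1}{4L}$, and for all $k\ge 1$ let $$\alpha_k=\frac{2}{k+1},\qquad \beta_k=\beta=\frac{1}{\sqrt K},\qquad \gamma_k\in[\beta_k,(1+\alpha_k)\beta_k].$$ Let $\{y_k\}_{k=1}^K$ be generated by the accelerated Markov gradient descent iteration for nonconvex problems (see context) with these step sizes, and let $y_R$ be selected at random from $\{y_k\}_{k=1}^K$, where $y_k$ is selected with probability $$p_k=\frac{\gamma_k(1-L\gamma_k)}{\sum_{j=1}^K\gamma_j(1-L\gamma_j)}.$$ Then $$\mathbb{E}\big[\|\nabla f(y_R)\|^2\big]\le \frac{2\big(\mathbb{E}[f(x_0)]-f^*\big)\big(4L+\sqrt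 K\big)}{K}+\frac{2M\big(LM(11+16C\log K)+2\big)}{\sqrt K}.$$
   Context: Setting. $\Xi$ is the finite state space of the chain $\{\xi_k\}$, $\pi$ its stationary distribution, $F(\cdot;\xi):\mathbb{R}^d\to\mathbb{R}$ is a function that is bounded below for each $\xi\in\Xi$, $f(x)=\mathbb{E}_{\pi}[F(x;\xi)]$, and $G(x;\xi)$ is the gradient of $F(\cdot;\xi)$ at $x$. $\|\cdot\|$ is the Euclidean norm. Mixing time. Since the chain is finite and ergodic, there is a constant $C>0$ such that, with $\tau(\gamma)=C\log(1/\gamma)$, one has $\|\mathbb{P}^k(\xi_0,\cdot)-\pi\|_{TV}\le\gamma$ for every $\gamma>0$, every $k\ge\tau(\gamma)$ and every $\xi_0\in\Xi$. Here $\mathbb{P}^k(\xi_0,\xi)$ is the probability that $\xi_k=\xi$ when the chain starts at $\xi_0$, and $\|\cdot\|_{TV}$ is the total variation distance. The constant $C$ in the claim is this constant. Algorithm (accelerated Markov gradient descent, nonconvex case). The initial points $x_0,\bar x_0\in\mathbb{R}^d$ are arbitrary. For $k=1,\dots,K$: $$y_k=(1-\alpha_k)\bar x_{k-1}+\alpha_k x_{k-1},\qquad x_k=x_{k-1}-\gamma_kG(y_k;\xi_k),\qquad \bar x_k=y_k-\beta_kG(y_k;\xi_k).$$ The samples $\xi_k$ are successive states of the Markov chain. $\mathbb{E}$ is the expectation over all randomness, including the independent random choice of the index $R$. *)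

(* Defs.v *)
From HB Require Import structures.
From mathcomp Require Import all_boot all_order all_algebra.
From mathcomp Require Import all_classical all_reals all_analysis.

Set Implicit Arguments.
Unset Strict Implicit.
Unset Printing Implicit Defensive.

Import Order.TTheory GRing.Theory Num.Theory.
Import numFieldNormedType.Exports.

Local Open Scope classical_set_scope.
Local Open Scope ring_scope.

(* The library norm of 'rV[R]_d is the sup norm, hence this definition;
   differentiability is the same for both norms. *)
Definition enorm (R : realType) (d : nat) (v : 'rV[R]_d) : R :=
  Num.sqrt (\sum_(i < d) v 0 i ^+ 2).

Definition gradient (R : realType) (d : nat) (h : 'rV[R]_d -> R)
    (x : 'rV[R]_d) : 'rV[R]_d :=
  \row_(i < d) 'D_(delta_mx 0 i) h x.

(* [gradient h x] is a meaningless value if the partial derivatives do not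
   exist, so differentiability is part of the relation. *)
Definition is_gradient (R : realType) (d : nat) (h : 'rV[R]_d -> R)
    (x g : 'rV[R]_d) : Prop :=
  differentiable h x /\ g = gradient h x.

Section FiniteChain.
Context {R : realType} {Xi : finType}.
Implicit Types (T : Xi -> Xi -> R) (pi mu nu : Xi -> R).

Definition is_dist mu : Prop :=
  (forall s, 0 <= mu s) /\ \sum_(s : Xi) mu s = 1.

Definition stochastic T : Prop := forall s, is_dist (T s).

Fixpoint kstep T (k : nat) (s t : Xi) : R :=
  if k is k'.+1 then \sum_(u : Xi) T s u * kstep T k' u t else (s == t)%:R.

Definition irreducible_chain T : Prop :=
  forall s t, exists k : nat, 0 < kstep T k s t.

(* The greatest common divisor of the set of return times to s is 1. *)
Definition aperiodic_chain T : Prop :=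
  forall (s : Xi) (m : nat),
    (forall k : nat, (0 < k)%N -> 0 < kstep T k s s -> (m %| k)%N) -> m = 1%N.

Definition stationary T pi : Prop :=
  is_dist pi /\ forall t, \sum_(s : Xi) pi s * T s t = pi t.

Definition tv_dist mu nu : R :=
  \big[Num.max/0]_(A : {set Xi}) `|\sum_(s in A) mu s - \sum_(s in A) nu s|.

Definition mixing_time (C g : R) : R := C * ln (1 / g).

Definition mixing_constant T pi (C : R) : Prop :=
  0 < C /\
  forall (g : R) (k : nat) (s0 : Xi),
    0 < g -> mixing_time C g <= k%:R -> tv_dist (kstep T k s0) pi <= g.

Definition mean_obj {d : nat} pi (F : 'rV[R]_d -> Xi -> R) (x : 'rV[R]_d) : R :=
  \sum_(s : Xi) pi s * F x s.

End FiniteChain.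

Section Process.
Context {R : realType} {d : nat} {Xi : finType}.
Context {disp : measure_display} {Omega : measurableType disp}.
Context (P : probability Omega R).

Definition random_vector (v : Omega -> 'rV[R]_d) : Prop :=
  forall i : 'I_d, measurable_fun [set: Omega] (fun w => v w 0 i).

Definition coord_events (v : Omega -> 'rV[R]_d) : set_system Omega :=
  [set A | exists (i : 'I_d) (B : set R),
     measurable B /\ A = [set w | B (v w 0 i)]].

Definition history (x0 xb0 : Omega -> 'rV[R]_d) (xi : nat -> Omega -> Xi)
    (J : set nat) : set_system Omega :=
  <<s coord_events x0 `|` coord_events xb0 `|`
      [set A | exists (j : nat) (s : Xi), J j /\ A = [set w | xi j w = s]] >>.

(* The law of xi_0 is arbitrary. The filtration includes the initial points,
   which may be random and correlated with xi_0; for constant x0 and xb0 this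
   is the usual Markov property. *)
Definition markov_chain (x0 xb0 : Omega -> 'rV[R]_d)
    (T : Xi -> Xi -> R) (xi : nat -> Omega -> Xi) : Prop :=
  (forall k s, measurable [set w | xi k w = s]) /\
  (forall (k : nat) (A : set Omega) (s t : Xi),
     history x0 xb0 xi [set j | (j <= k)%N] A ->
     P (A `&` [set w | xi k w = s] `&` [set w | xi k.+1 w = t]) =
     (P (A `&` [set w | xi k w = s]) * (T s t)%:E)%E).

(* Independence is from the initial points and the whole chain together. *)
Definition random_index (x0 xb0 : Omega -> 'rV[R]_d)
    (xi : nat -> Omega -> Xi) (K : nat) (p : nat -> R)
    (rho : Omega -> nat) : Prop :=
  [/\ forall w, (1 <= rho w <= K)%N,
      forall k, measurable [set w | rho w = k],
      forall k, (1 <= k <= K)%N -> P [set w | rho w = k] = (p k)%:E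
    & forall k A, history x0 xb0 xi [set: nat] A ->
        P (A `&` [set w | rho w = k]) = (P A * P [set w | rho w = k])%E].

Definition accelerated_mgd (G : 'rV[R]_d -> Xi -> 'rV[R]_d)
    (alpha beta gamma : nat -> R) (xi : nat -> Omega -> Xi) (K : nat)
    (x xb y : nat -> Omega -> 'rV[R]_d) : Prop :=
  forall (k : nat) (w : Omega), (1 <= k <= K)%N ->
    [/\ y k w = (1 - alpha k) *: xb k.-1 w + alpha k *: x k.-1 w,
        x k w = x k.-1 w - gamma k *: G (y k w) (xi k w)
      & xb k w = y k w - beta k *: G (y k w) (xi k w)].

End Process.

(* Main.v *)
Require Import Defs.
From HB Require Import structures.
From mathcomp Require Import all_boot all_order all_algebra.
From mathcomp Require Import all_classical all_reals all_analysis.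
From mathcomp Require Import measurable_realfun ring lra.

Set Implicit Arguments.
Unset Strict Implicit.
Unset Printing Implicit Defensive.

Import Order.TTheory GRing.Theory Num.Theory.
Import numFieldNormedType.Exports.

Local Open Scope classical_set_scope.
Local Open Scope ring_scope.

(* The x-sequence is gradient descent with gradients taken at y_k, and
   |y_k - x_{k-1}| <= beta M, so the descent lemma gives
     f(x_k) <= f(x_{k-1}) - gamma_k |grad f(y_k)|^2 + gamma_k bias_k
               + 2 beta^2 L M^2,
   where bias_k = <grad f(y_k), grad f(y_k) - G(y_k; xi_k)>.  Put
   q = floor(C log K).  Replacing y_k by y_{k-q} costs 8 beta L M^2 q, and since
   y_{k-q} only depends on the history up to time k-q-1, from which the chain
   makes q+1 > C log K steps to xi_k, the lagged bias has expectation at most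
   (2M/K) E|grad f(y_{k-q})|.

   Bounding that gradient by M is affordable only if 2L >= beta, and then
   telescoping gives the claim.  If 2L < beta, the bound follows instead from
   |grad f|^2 <= 2L (f - fstar): it suffices that E f(y_k) - fstar stays below
   2 (E f(x_0) - fstar) + O(L M^2 (1 + C log K)), where the gradients in the error
   terms are compared with grad f(x_0), itself controlled by f(x_0) - fstar.

   All estimates are pathwise, up to a nonnegative combination of the bounded
   lagged biases, so that integrability of f(x_0) is never needed. *)

(** * Euclidean geometry and the descent lemma *)

Section Euclid.
Context {R : realType} {d : nat}.
Implicit Types u v w : 'rV[R]_d.

Definition dotp u v : R := \sum_(i < d) u 0 i * v 0 i.

Lemma dotpC u v : dotp u v = dotp v u.
Proof. by apply: eq_bigr => i _; rewrite mulrC. Qed.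

Lemma dotpDl u v w : dotp (u + v) w = dotp u w + dotp v w.
Proof. by rewrite -big_split; apply: eq_bigr => i _; rewrite mxE mulrDl. Qed.

Lemma dotpZl a u v : dotp (a *: u) v = a * dotp u v.
Proof. by rewrite mulr_sumr; apply: eq_bigr => i _; rewrite mxE mulrA. Qed.

Lemma dotpNl u v : dotp (- u) v = - dotp u v.
Proof. by rewrite -scaleN1r dotpZl mulN1r. Qed.

Lemma dotpBl u v w : dotp (u - v) w = dotp u w - dotp v w.
Proof. by rewrite dotpDl dotpNl. Qed.

Lemma dotpDr u v w : dotp u (v + w) = dotp u v + dotp u w.
Proof. by rewrite dotpC dotpDl !(dotpC u). Qed.

Lemma dotpZr a u v : dotp u (a *: v) = a * dotp u v.
Proof. by rewrite dotpC dotpZl dotpC. Qed.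

Lemma dotpBr u v w : dotp u (v - w) = dotp u v - dotp u w.
Proof. by rewrite dotpC dotpBl !(dotpC u). Qed.

Lemma dotp_sumr (I : finType) u (v : I -> 'rV[R]_d) :
  dotp u (\sum_s v s) = \sum_s dotp u (v s).
Proof.
rewrite [RHS]exchange_big /=; apply: eq_bigr => i _.
by rewrite summxE mulr_sumr.
Qed.

Lemma dotpvv_ge0 u : 0 <= dotp u u.
Proof. by apply: sumr_ge0 => i _; rewrite -expr2 sqr_ge0. Qed.

Lemma enorm_ge0 u : 0 <= enorm u.
Proof. exact: sqrtr_ge0. Qed.

Lemma enorm_sqr u : enorm u ^+ 2 = dotp u u.
Proof.
rewrite sqr_sqrtr; first by apply: eq_bigr => i _; rewrite expr2.
by apply: sumr_ge0 => i _; rewrite sqr_ge0.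
Qed.

Lemma le_enorm u (a : R) : 0 <= a -> dotp u u <= a ^+ 2 -> enorm u <= a.
Proof.
move=> a0 h; rewrite -(@ler_pXn2r _ 2) ?nnegrE ?enorm_ge0//.
by rewrite enorm_sqr.
Qed.

(** Cauchy-Schwarz, from the nonnegative square of [dotp v v *: u - dotp u v *: v] divided by
    [dotp v v]. *)
Lemma dotp_le u v : dotp u v <= enorm u * enorm v.
Proof.
have [n0|n0] := leP (dotp u v) 0.
  by rewrite (le_trans n0)// mulr_ge0 ?enorm_ge0.
rewrite -(@ler_pXn2r _ 2) ?nnegrE ?mulr_ge0 ?enorm_ge0 ?(ltW n0)//.
rewrite exprMn !enorm_sqr.
have := dotpvv_ge0 (dotp v v *: u - dotp u v *: v).
rewrite !(dotpBl, dotpBr, dotpZl, dotpZr) (dotpC v u).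
have v0 := dotpvv_ge0 v; have [v0'|v0'] := eqVneq (dotp v v) 0.
  (* If [dotp v v = 0] while [dotp u v > 0], this [a] gives [u - a *: v] the square
     [- 2 - dotp u u], which is negative. *)
  pose a := (1 + dotp u u) / dotp u v.
  have ha : a * dotp u v = 1 + dotp u u by rewrite divfK ?gt_eqF.
  have := dotpvv_ge0 (u - a *: v).
  rewrite !(dotpBl, dotpBr, dotpZl, dotpZr) (dotpC v u) v0' ha.
  have := dotpvv_ge0 u; lra.
have {}v0 : 0 < dotp v v by rewrite lt_def v0' v0.
move=> h; rewrite -subr_ge0 -(pmulr_rge0 _ v0); lra.
Qed.

Lemma enormN u : enorm (- u) = enorm u.
Proof. by congr Num.sqrt; apply: eq_bigr => i _; rewrite mxE sqrrN. Qed.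

Lemma enormB u v : enorm (u - v) = enorm (v - u).
Proof. by rewrite -enormN opprB. Qed.

Lemma normr_dotp_le u v : `|dotp u v| <= enorm u * enorm v.
Proof. by rewrite ler_norml dotp_le lerNl -dotpNl -(enormN u) dotp_le. Qed.

Lemma enormD u v : enorm (u + v) <= enorm u + enorm v.
Proof.
apply: le_enorm; first by rewrite addr_ge0 ?enorm_ge0.
rewrite sqrrD !enorm_sqr !(dotpDl, dotpDr) (dotpC v u).
have := dotp_le u v; lra.
Qed.

Lemma enormZ a u : 0 <= a -> enorm (a *: u) = a * enorm u.
Proof.
move=> a0; apply/eqP; rewrite -(@eqrXn2 _ 2) ?mulr_ge0 ?enorm_ge0//.
by rewrite exprMn !enorm_sqr dotpZl dotpZr mulrA expr2.
Qed.

Lemma coord_le_enorm u i : `|u 0 i| <= enorm u.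
Proof.
rewrite -(@ler_pXn2r _ 2) ?nnegrE ?enorm_ge0// enorm_sqr real_normK ?num_real//.
rewrite /dotp (bigD1 i)//= -expr2 lerDl.
by apply: sumr_ge0 => j _; rewrite -expr2 sqr_ge0.
Qed.

(** The sum of absolute values lies in between. The crude factor [d] suffices for comparing
    Euclidean and sup-norm neighbourhoods. *)
Lemma enorm_le_coord u (c : R) :
  (forall i, `|u 0 i| <= c) -> enorm u <= d%:R * c.
Proof.
move=> uc; apply: (@le_trans _ _ (\sum_(i < d) `|u 0 i|)); last first.
  by rewrite mulr_natl -[X in _ *+ X]card_ord -sumr_const ler_sum.
apply: le_enorm; first exact: sumr_ge0.
rewrite expr2 mulr_suml; apply: ler_sum => i _.
rewrite (le_trans (ler_norm _))// normrM ler_wpM2l// (bigD1 i)//= lerDl.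
exact: sumr_ge0.
Qed.

End Euclid.

Section Smooth.
Context {R : realType} {d : nat}.
Implicit Types (x v : 'rV[R]_d) (h : 'rV[R]_d -> R).

Lemma derive_dotp h x v :
  differentiable h x -> 'D_v h x = dotp (gradient h x) v.
Proof.
move=> dh; rewrite deriveE// [in LHS](row_sum_delta v) linear_sum.
by apply: eq_bigr => i _; rewrite linearZ mxE deriveE// [RHS]mulrC.
Qed.

(** The difference quotient of the restriction to the line at [t] is the directional quotient of [h]
    at [x + t *: v]. *)
Lemma is_derive_line h x v (t : R) : differentiable h (x + t *: v) ->
  is_derive t 1 (fun s : R => h (x + s *: v)) (dotp (gradient h (x + t *: v)) v).
Proof.
move=> dh; rewrite -derive_dotp//.
have E : (fun s : R => s^-1 *: (h (x + (s *: 1 + t) *: v) - h (x + t *: v))) =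
    (fun s : R => s^-1 *: (h (s *: v + (x + t *: v)) - h (x + t *: v))).
  apply/funext => s; congr (_ *: (h _ - _)).
  by rewrite [s *: 1]mulr1 scalerDl addrCA.
have dv := @diff_derivable _ _ _ h (x + t *: v) v dh.
by split; rewrite /derivable /derive /= E.
Qed.

(** No integration along the segment: subtracting the linear and quadratic terms leaves a function
    [psi] of the line parameter whose derivative on [[0, 1]] is nonpositive by the Lipschitz bound,
    and the claim is [psi 1 <= psi 0]. *)
Lemma descent h (L : R) x v :
  (forall z, differentiable h z) ->
  (forall z w, enorm (gradient h z - gradient h w) <= L * enorm (z - w)) ->
  h (x + v) <= h x + dotp (gradient h x) v + L / 2 * enorm v ^+ 2.
Proof.
move=> dh lip.
set g := dotp (gradient h x) v; set c := L / 2 * enorm v ^+ 2.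
pose psi := fun s : R => h (x + s *: v) - (s * g + s ^+ 2 * c).
have dpsi (t : R) : is_derive t 1 psi
    (dotp (gradient h (x + t *: v)) v - (g + 2 * t * c)).
  apply: is_deriveB; first exact: is_derive_line.
  apply: is_derive_eq.
  by rewrite /GRing.scale/=; ring.
have le10 : psi 1 <= psi 0.
  apply: (@ler0_derive1_le_cc _ psi 0 1); rewrite ?in_itv/= ?lexx ?ler01//.
  - move=> t; rewrite in_itv/= => /andP[t0 _].
    rewrite derive1E (@derive_val _ _ _ _ _ _ _ (dpsi t)) subr_le0 -lerBlDl -dotpBl.
    apply: (le_trans (dotp_le _ _)).
    have := lip (x + t *: v) x; rewrite addrAC subrr add0r enormZ ?(ltW t0)//.
    move=> /(ler_wpM2r (enorm_ge0 v)) /le_trans; apply.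
    by rewrite le_eqVlt; apply/orP; left; apply/eqP; rewrite /c; field.
  - apply: derivable_within_continuous => t _.
    exact: (@ex_derive _ _ _ _ _ _ _ (dpsi t)).
move: le10; rewrite /psi scale1r scale0r addr0 !mul1r expr1n mul1r mul0r.
rewrite expr0n/= mul0r addr0 subr0; lra.
Qed.

End Smooth.

(** * Pathwise analysis of the iteration *)

Ltac nneg := repeat first [exact: ler0n | exact: enorm_ge0 | exact: sqr_ge0
  | by apply: ltW | done | apply: addr_ge0 | apply: mulr_ge0 | rewrite invr_ge0].

Section Iteration.
Context {R : realType} {d : nat} {Xi : Type}.
Context (f : 'rV[R]_d -> R) (G : 'rV[R]_d -> Xi -> 'rV[R]_d).
Context (fstar L M : R) (L_gt0 : 0 < L) (M_gt0 : 0 < M).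
Local Notation g := (gradient f).
Context (df : forall z, differentiable f z) (f_ge : forall z, fstar <= f z).
Context (lipg : forall z w, enorm (g z - g w) <= L * enorm (z - w)).
Context (lipG : forall z w s, enorm (G z s - G w s) <= L * enorm (z - w)).
Context (gM : forall z, enorm (g z) <= M) (GM : forall z s, enorm (G z s) <= M).
Context (K : nat) (b : R) (b_gt0 : 0 < b) (b2K : b ^+ 2 * K%:R = 1).
Context (Lb : L * b <= 1 / 4) (alpha gamma : nat -> R).
Context (alphaE : forall k, (1 <= k)%N -> alpha k = 2 / (k%:R + 1)).
Context (gammaP : forall k, (1 <= k)%N ->
  b <= gamma k <= (1 + alpha k) * b).
Context (s : nat -> Xi) (x xb y : nat -> 'rV[R]_d).
Context (yE : forall k, (1 <= k <= K)%N ->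
  y k = (1 - alpha k) *: xb k.-1 + alpha k *: x k.-1).
Context (xE : forall k, (1 <= k <= K)%N ->
  x k = x k.-1 - gamma k *: G (y k) (s k)).
Context (xbE : forall k, (1 <= k <= K)%N ->
  xb k = y k - b *: G (y k) (s k)).

Let bM_ge0 : 0 <= b * M. Proof. by rewrite mulr_ge0 ?ltW. Qed.

Lemma alpha_itv k : (1 <= k)%N -> 0 <= alpha k <= 1.
Proof.
move=> k1; rewrite alphaE//.
have k1' : (1 : R) <= k%:R by rewrite ler1n.
rewrite divr_ge0 ?addr_ge0//= ler_pdivrMr; lra.
Qed.

Lemma alpha1 : alpha 1 = 1.
Proof. by rewrite alphaE// divff. Qed.

Lemma gamma_itv k : (1 <= k)%N -> b <= gamma k <= 2 * b.
Proof.
move=> k1; have /andP[-> h] /= := gammaP k1; apply: (le_trans h).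
by rewrite ler_wpM2r ?(ltW b_gt0)//; have := alpha_itv k1; lra.
Qed.

Lemma gamma_ge0 k : (1 <= k)%N -> 0 <= gamma k.
Proof. by move=> /gamma_itv /andP[+ _]; apply: le_trans; exact: ltW. Qed.

(** A gradient step of length [1 / L] from [z] decreases [f] by at least [|g z|^2 / (2 L)] and
    cannot go below [fstar]. *)
Lemma grad_sqr_le z : enorm (g z) ^+ 2 <= 2 * L * (f z - fstar).
Proof.
have := descent z (- L^-1 *: g z) df lipg.
rewrite dotpZr -enorm_sqr scaleNr enormN enormZ ?invr_ge0 ?(ltW L_gt0)// => h.
have {h} := le_trans (f_ge _) h.
have L0 : L != 0 by rewrite gt_eqF.
rewrite (_ : _ + _ + _ = f z - enorm (g z) ^+ 2 / (2 * L)); last by field.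
have L20 : 0 < 2 * L by rewrite mulr_gt0.
by rewrite lerBrDr -lerBrDl (ler_pdivrMr _ _ L20) [_ * (2 * L)]mulrC.
Qed.

Lemma grad_dist z w : enorm (g z) <= enorm (g w) + L * enorm (z - w).
Proof.
rewrite -[g z](subrK (g w)) addrC; apply: le_trans (enormD _ _) _.
by rewrite lerD2l lipg.
Qed.

(** The difference obeys a recursion with factor [1 - alpha k] and a new term of size at most
    [(gamma k - b) M <= alpha k b M], so the bound [b M] is kept by convexity. Since [alpha 1 = 1],
    an initial gap between [x 0] and [xb 0] disappears at the first step. *)
Lemma xb_sub_x k : (1 <= k <= K)%N -> enorm (xb k - x k) <= b * M.
Proof.
elim: k => // k IH /andP[_ kK].
have k1 : (1 <= k.+1 <= K)%N by [].
rewrite xbE// xE// yE//= .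
rewrite (_ : _ - _ = (1 - alpha k.+1) *: (xb k - x k) +
    (gamma k.+1 - b) *: G (y k.+1) (s k.+1)); last first.
  rewrite yE//=; apply/rowP => i; rewrite !mxE; ring.
have /andP[a0 a1] := @alpha_itv k.+1 isT.
have /andP[g0 g1] := @gammaP k.+1 isT.
have A : enorm ((1 - alpha k.+1) *: (xb k - x k)) <= (1 - alpha k.+1) * (b * M).
  rewrite enormZ ?subr_ge0//; case: (posnP k) => [->|kp].
    by rewrite alpha1 subrr !mul0r.
  by rewrite ler_wpM2l ?subr_ge0// IH// kp ltnW.
have B : enorm ((gamma k.+1 - b) *: G (y k.+1) (s k.+1)) <=
    alpha k.+1 * (b * M).
  rewrite enormZ ?subr_ge0// mulrA.
  apply: ler_pM => //; rewrite ?subr_ge0 ?enorm_ge0//; lra.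
apply: le_trans (enormD _ _) _; lra.
Qed.

(** The factor [1 - alpha k] is kept because [f_step] balances it against the factor [1 + alpha k]
    in the bound on [gamma k]. *)
Lemma y_sub_x k : (1 <= k <= K)%N ->
  enorm (y k - x k.-1) <= (1 - alpha k) * (b * M).
Proof.
case: k => // k k1; rewrite yE//=.
have /andP[a0 a1] := @alpha_itv k.+1 isT.
rewrite (_ : _ - _ = (1 - alpha k.+1) *: (xb k - x k)); last first.
  by apply/rowP => i; rewrite !mxE; ring.
rewrite enormZ ?subr_ge0//; case: (posnP k) => [->|kp].
  by rewrite alpha1 subrr !mul0r.
by rewrite ler_wpM2l ?subr_ge0// xb_sub_x// kp ltnW.
Qed.

Lemma y1E : (0 < K)%N -> y 1 = x 0.
Proof. by move=> K0; rewrite yE//= alpha1 subrr scale0r add0r scale1r. Qed.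

Lemma y_step k : (1 <= k < K)%N -> enorm (y k.+1 - y k) <= 2 * (b * M).
Proof.
move=> /andP[k1 kK].
have kK' : (1 <= k <= K)%N by rewrite k1 ltnW.
rewrite (_ : _ - _ = - (b *: G (y k) (s k)) +
    alpha k.+1 *: (x k - xb k)); last first.
  by rewrite yE//= xbE//; apply/rowP => i; rewrite !mxE; ring.
have /andP[a0 a1] := @alpha_itv k.+1 isT.
apply: le_trans (enormD _ _) _; rewrite enormN !enormZ ?(ltW b_gt0)//.
rewrite enormB; have := xb_sub_x kK'; have := enorm_ge0 (xb k - x k).
have := GM (y k) (s k); have := b_gt0; nra.
Qed.

Lemma y_dist k n : (1 <= k)%N -> (k + n <= K)%N ->
  enorm (y (k + n)%N - y k) <= 2 * (b * M) * n%:R.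
Proof.
move=> k1; elim: n => [|n IH] knK.
  by rewrite addn0 subrr -(scale0r 0) enormZ// mul0r mulr0.
rewrite addnS in knK *.
have A := IH (ltnW knK).
have B : enorm (y (k + n).+1 - y (k + n)%N) <= 2 * (b * M).
  by apply: y_step; rewrite addn_gt0 k1 knK.
rewrite (_ : _ - y k = (y (k + n)%N - y k) + (y (k + n).+1 - y (k + n)%N)).
  by apply: le_trans (enormD _ _) _; rewrite -[n.+1%:R]natr1 mulrDr mulr1 lerD.
by apply/rowP => i; rewrite !mxE; ring.
Qed.

Lemma x_dist n : (n <= K)%N -> enorm (x n - x 0) <= 2 * (b * M) * n%:R.
Proof.
elim: n => [|n IH] nK.
  by rewrite subrr -(scale0r 0) enormZ// mul0r mulr0.
rewrite xE//= addrAC -[n.+1%:R]natr1 mulrDr mulr1.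
apply: le_trans (enormD _ _) _; rewrite lerD ?IH 1?ltnW//.
have /andP[g0 g1] := @gamma_itv n.+1 isT.
rewrite enormN enormZ ?gamma_ge0// mulrA.
by apply: ler_pM; rewrite ?gamma_ge0 ?enorm_ge0.
Qed.

(** The path starts at [y 1 = x 0] and moves by at most [2 b M] per step. The excess is of order
    [sqrt K], but its uses carry another factor [b], and [b ^+ 2 * K%:R = 1]. *)
Lemma grad_y_le k : (1 <= k <= K)%N ->
  enorm (g (y k)) <= enorm (g (x 0)) + 2 * L * M * b * K%:R.
Proof.
case: k => // k /= kK; apply: le_trans (grad_dist _ (x 0)) _.
have := @y_dist 1 k isT kK; rewrite add1n y1E; last by case: (K) kK.
move=> h; rewrite lerD2l -!mulrA mulrCA ler_wpM2l ?(ltW L_gt0)//.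
apply: (le_trans h); rewrite (mulrC M) -!mulrA ler_wpM2l// ler_wpM2l ?(ltW b_gt0)//.
by rewrite [leRHS]mulrC ler_wpM2l ?(ltW M_gt0)// ler_nat ltnW.
Qed.

Lemma grad_x_le n : (n <= K)%N ->
  enorm (g (x n)) <= enorm (g (x 0)) + 2 * L * M * b * K%:R.
Proof.
move=> nK; apply: le_trans (grad_dist _ (x 0)) _.
have h := x_dist nK.
rewrite lerD2l -!mulrA mulrCA ler_wpM2l ?(ltW L_gt0)//.
apply: (le_trans h); rewrite (mulrC M) -!mulrA ler_wpM2l// ler_wpM2l ?(ltW b_gt0)//.
by rewrite [leRHS]mulrC ler_wpM2l ?(ltW M_gt0)// ler_nat.
Qed.

(** The descent lemma is applied at [x k.-1]; moving the gradient from there to [y k] costs at most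
    [L (1 - alpha k) b M] in norm. This error and the quadratic term are estimated together. *)
Lemma f_step k : (1 <= k <= K)%N ->
  f (x k) <= f (x k.-1) - gamma k * dotp (g (y k)) (G (y k) (s k))
             + 2 * b ^+ 2 * L * M ^+ 2.
Proof.
move=> kK; have /andP[k1 _] := kK; rewrite xE//.
apply: le_trans (descent _ _ df lipg) _.
rewrite -!addrA lerD2l -scaleNr dotpZr scaleNr enormN enormZ ?gamma_ge0//.
rewrite exprMn.
set u := G _ _; have /andP[a0 a1] := alpha_itv k1.
have /andP[g0 g1] := gammaP k1.
have gg := gamma_ge0 k1.
have D : - dotp (g (x k.-1)) u <=
   - dotp (g (y k)) u + L * ((1 - alpha k) * (b * M)) * M.
  rewrite addrC -lerBlDr opprK addrC -dotpBl.
  apply: le_trans (dotp_le _ _) _.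
  apply: ler_pM; rewrite ?enorm_ge0 ?GM//.
  by apply: le_trans (lipg _ _) _; rewrite ler_wpM2l ?(ltW L_gt0)// y_sub_x.
have U2 : enorm u ^+ 2 <= M ^+ 2 by rewrite lerXn2r ?nnegrE ?enorm_ge0 ?(ltW M_gt0) ?GM.
have D' := ler_wpM2l gg D.
have LM : 0 <= L * M ^+ 2 by rewrite mulr_ge0 ?sqr_ge0 ?(ltW L_gt0).
have E1 : L / 2 * (gamma k ^+ 2 * enorm u ^+ 2) <=
    L * M ^+ 2 * (((1 + alpha k) * b) ^+ 2 / 2).
  have g2 : gamma k ^+ 2 <= ((1 + alpha k) * b) ^+ 2.
    by rewrite lerXn2r ?nnegrE// (le_trans gg).
  have := ler_pM (sqr_ge0 _) (sqr_ge0 _) g2 U2.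
  move/(ler_wpM2l (_ : 0 <= L / 2)); rewrite divr_ge0 ?(ltW L_gt0)// => /(_ isT).
  by move=> /le_trans; apply; rewrite le_eqVlt; apply/orP; left; apply/eqP; field.
have E2 : gamma k * (L * ((1 - alpha k) * (b * M)) * M) <=
    L * M ^+ 2 * ((1 + alpha k) * (1 - alpha k) * b ^+ 2).
  have h : 0 <= L * M ^+ 2 * ((1 - alpha k) * b).
    by rewrite !mulr_ge0 ?subr_ge0 ?sqr_ge0// ltW.
  have := ler_wpM2r h g1 => h'.
  rewrite (_ : _ * _ = gamma k * (L * M ^+ 2 * ((1 - alpha k) * b))); last by ring.
  by apply: (le_trans h'); rewrite le_eqVlt; apply/orP; left; apply/eqP; ring.
(* The gap between the two sides is exactly [b^2 (1 - alpha k)^2 / 2]. *)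
have E3 : (1 + alpha k) * (1 - alpha k) * b ^+ 2 + ((1 + alpha k) * b) ^+ 2 / 2
   <= 2 * b ^+ 2.
  rewrite -subr_ge0 (_ : _ - _ = b ^+ 2 * ((1 - alpha k) ^+ 2 / 2)); last by field.
  by rewrite mulr_ge0 ?sqr_ge0// divr_ge0 ?sqr_ge0.
have := ler_wpM2l LM E3; rewrite mulrDr; lra.
Qed.

Lemma f_telescope n : (n <= K)%N ->
  f (x n) <= f (x 0) + n%:R * (2 * b ^+ 2 * L * M ^+ 2)
    + \sum_(1 <= j < n.+1) - (gamma j * dotp (g (y j)) (G (y j) (s j))).
Proof.
elim: n => [|n IH] nK; first by rewrite big_geq// mul0r !addr0.
have := @f_step n.+1 nK; rewrite big_nat_recr//= -[n.+1%:R]natr1.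
have := IH (ltnW nK); lra.
Qed.

(** * The sampling bias and its lagged version *)

Definition bias k := dotp (g (y k)) (g (y k) - G (y k) (s k)).

(* The bias with the iterate frozen [q] steps before the sample, minus the
   amount by which imperfect mixing can make its expectation positive. *)
Definition lagged_bias q j :=
  dotp (g (y (j - q))) (g (y (j - q)) - G (y (j - q)) (s j))
  - 2 * M / K%:R * enorm (g (y (j - q))).

Lemma bias_le q j : (q < j <= K)%N ->
  bias j <= lagged_bias q j + 2 * M / K%:R * enorm (g (y (j - q)))
            + 8 * b * L * M ^+ 2 * q%:R.
Proof.
move=> /andP[qj jK]; rewrite /lagged_bias subrK /bias.
have jq : (1 <= j - q)%N by rewrite subn_gt0.
have := @y_dist (j - q) q jq; rewrite subnK; last exact: ltnW.
move=> /(_ jK); set z := y (j - q); set w := y j; set t := s j => D.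
rewrite -lerBlDl.
(* The change of the bias from [z] to [w] splits into a change of the first factor and a change of
   the second. Each part is at most [4 b L M^2 q]. *)
rewrite (_ : _ - _ = dotp (g w - g z) (g w - G w t)
   + dotp (g z) ((g w - g z) - (G w t - G z t))); last first.
  by rewrite !(dotpBl, dotpBr); ring.
have LD : L * enorm (w - z) <= L * (2 * (b * M) * q%:R).
  by rewrite ler_wpM2l ?(ltW L_gt0).
have A : dotp (g w - g z) (g w - G w t) <= L * (2 * (b * M) * q%:R) * (2 * M).
  apply: le_trans (dotp_le _ _) _; apply: ler_pM; rewrite ?enorm_ge0//.
    exact: le_trans (lipg _ _) _.
  apply: le_trans (enormD _ _) _; rewrite enormN.
  by rewrite mulr_natl mulr2n lerD.
have B : dotp (g z) ((g w - g z) - (G w t - G z t)) <=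
    M * (2 * (L * (2 * (b * M) * q%:R))).
  apply: le_trans (dotp_le _ _) _; apply: ler_pM; rewrite ?enorm_ge0//.
  apply: le_trans (enormD _ _) _; rewrite enormN mulr_natl mulr2n.
  by apply: lerD; [exact: le_trans (lipg _ _) _|exact: le_trans (lipG _ _ _) _].
lra.
Qed.

(** This serves the first [q] steps, where no iterate lies [q] steps back. *)
Lemma bias_le_crude j : bias j <= 2 * M ^+ 2.
Proof.
apply: le_trans (dotp_le _ _) _; rewrite expr2 mulrCA.
apply: ler_pM; rewrite ?enorm_ge0//.
by apply: le_trans (enormD _ _) _; rewrite enormN mulr_natl mulr2n lerD.
Qed.

Let invK : (K%:R : R)^-1 = b ^+ 2.
Proof.
rewrite -[RHS](mulfK (_ : K%:R != 0)) ?b2K ?mul1r//.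
by apply: contra_eq_neq b2K => ->; rewrite mulr0 eq_sym oner_eq0.
Qed.

Lemma sum_leq_nat q n : \sum_(1 <= j < n.+1) (j <= q)%:R = (minn q n)%:R :> R.
Proof.
elim: n => [|n IH]; first by rewrite big_geq// minn0.
rewrite big_nat_recr//= IH; case/boolP: (n < q)%N => [nq|].
  by rewrite (minn_idPr (ltnW nq)) (minn_idPr nq) natr1.
by rewrite -leqNgt addr0 => qn; rewrite (minn_idPl qn) (minn_idPl (leqW qn)).
Qed.

(** The constants: telescoping gives [2], imperfect mixing [8], the lag [16 q], and the first [q]
    steps [8 q], all in units of [L M^2]. *)
Lemma large_L_bound q : b <= 2 * L ->
  \sum_(1 <= k < K.+1) gamma k * enorm (g (y k)) ^+ 2 <=
  (f (x 0) - fstar) + L * M ^+ 2 * (10 + 24 * q%:R)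
  + \sum_(1 <= j < K.+1 | (q < j)%N) gamma j * lagged_bias q j.
Proof.
move=> bL; have tele := f_telescope (leqnn K).
have {}tele := le_trans (f_ge _) tele.
have K0 : 0 <= (K%:R : R) by [].
(* [E] is the error of one step [j > q]: the factor [2 b] bounding [gamma j], times the lag cost
   [8 b L M^2 q] plus the mixing cost [2 M^2 / K]. *)
have [E defE] : {E | E = 16 * b ^+ 2 * L * M ^+ 2 * q%:R +
  4 * b * M ^+ 2 / K%:R} by eexists.
have term j : (1 <= j < K.+1)%N ->
    gamma j * enorm (g (y j)) ^+ 2 <=
    gamma j * dotp (g (y j)) (G (y j) (s j)) +
    (if (q < j)%N then gamma j * lagged_bias q j else 0)
    + E + (j <= q)%:R * (4 * b * M ^+ 2).
  move=> /andP[j1 jK]; rewrite ltnS in jK.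
  have /andP[g1 g2] := gamma_itv j1; have g0 := gamma_ge0 j1.
  rewrite enorm_sqr (_ : dotp _ _ = dotp (g (y j)) (G (y j) (s j)) + bias j);
    last by rewrite /bias dotpBr addrCA subrr addr0.
  rewrite mulrDr -2!addrA lerD2l.
  have E0 : 0 <= E.
    by rewrite defE; nneg.
  have [qj|jq] := ltnP q j; last first.
    rewrite mul1r add0r; apply: ler_wpDl => //.
    have /(ler_wpM2l g0)/le_trans := bias_le_crude j; apply.
    rewrite (_ : 4 * b * _ = 2 * b * (2 * M ^+ 2)); last by ring.
    by rewrite ler_wpM2r//; nneg.
  rewrite mul0r addr0.
  have := @bias_le q j; rewrite qj jK => /(_ isT)/(ler_wpM2l g0)/le_trans; apply.
  rewrite -addrA mulrDr lerD2l.
  apply: (@le_trans _ _ (2 * b * (2 * M / K%:R * M + 8 * b * L * M ^+ 2 * q%:R))).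
    apply: ler_pM => //.
      by nneg.
    by rewrite lerD2r ler_wpM2l//; nneg.
  by rewrite le_eqVlt; apply/orP; left; apply/eqP; rewrite defE; ring.
apply: (le_trans (ler_sum_nat term)).
rewrite !big_split/= -big_mkcond/= -mulr_suml sum_leq_nat.
rewrite sumr_const_nat subSS subn0 -[E *+ K]mulr_natr.
have -> : E * K%:R = 16 * L * M ^+ 2 * q%:R + 4 * b * M ^+ 2.
  rewrite defE invK mulrDl.
  rewrite (_ : 16 * b ^+ 2 * L * M ^+ 2 * q%:R * K%:R =
    16 * L * M ^+ 2 * q%:R * (b ^+ 2 * K%:R)); last by ring.
  by rewrite -(mulrA _ (b ^+ 2)) b2K !mulr1.
rewrite sumrN in tele.
have {}tele : \sum_(1 <= j < K.+1) gamma j * dotp (g (y j)) (G (y j) (s j)) <=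
    f (x 0) - fstar + 2 * (L * M ^+ 2).
  rewrite (_ : K%:R * _ = 2 * (L * M ^+ 2)) in tele; first by lra.
  by transitivity (2 * (L * M ^+ 2) * (b ^+ 2 * K%:R)); [ring | rewrite b2K mulr1].
(* Here [b <= 2 * L] turns the error terms without a factor [L] into multiples of [L M^2]. *)
have h1 : 4 * b * M ^+ 2 <= 8 * (L * M ^+ 2).
  by rewrite [leRHS]mulrA ler_wpM2r ?sqr_ge0//; lra.
have h2 : (minn q K)%:R * (4 * b * M ^+ 2) <= q%:R * (8 * (L * M ^+ 2)).
  apply: ler_pM => //; first by nneg.
  by rewrite ler_nat geq_minl.
lra.
Qed.

(** The decrease [|g (y j)|^2] is discarded in the telescoped sum, and [y k] is compared with
    [x k.-1]. Every error without a factor [L] carries [b M |g (x 0)|]; these add up to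
    [(5 + 2 t) b M |g (x 0)|], which the inequality [amgm] splits into one more [f (x 0) - fstar]
    and a multiple of [L M^2]. *)
Lemma small_L_bound q k : (1 <= k <= K)%N ->
  f (y k) - fstar <= 2 * (f (x 0) - fstar) + L * M ^+ 2 * (19 + 27 * q%:R)
  + \sum_(1 <= j < k | (q < j)%N) gamma j * lagged_bias q j.
Proof.
case: k => // n /= nK.
have delta0 : 0 <= f (x 0) - fstar by rewrite subr_ge0.
have A0 : 0 <= L * M ^+ 2 by rewrite mulr_ge0 ?sqr_ge0 ?(ltW L_gt0).
have [->|n0] := posnP n.
  rewrite y1E; last exact: leq_ltn_trans nK.
  rewrite big_geq// addr0.
  have : 0 <= L * M ^+ 2 * (19 + 27 * q%:R) by nneg.
  lra.
set S := \sum_(_ <= _ < _ | _) _.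
(* As [n > 0], the index [n.+1 <= K] forces [K >= 2]. *)
have b22 : b ^+ 2 <= 1 / 2.
  have : (2 : R) <= K%:R by rewrite ler_nat (leq_trans _ nK).
  move=> /(ler_wpM2l (sqr_ge0 b)); rewrite b2K; lra.
set g0 := enorm (g (x 0)); have g00 : 0 <= g0 := enorm_ge0 _.
(* [t] counts the steps [j <= q]. Capping it by [n] ensures [b ^+ 2 * t <= 1], so the square of [t]
   in [c1] costs only a linear term. *)
set t : R := (minn q n)%:R.
have t0 : 0 <= t by [].
have tq : t <= q%:R by rewrite ler_nat geq_minl.
have tK : t <= K%:R by rewrite ler_nat (leq_trans (geq_minr _ _))// ltnW.
have b2t : b ^+ 2 * t <= 1 by rewrite -[leRHS]b2K ler_wpM2l ?sqr_ge0.
have [E defE] : {E | E = 16 * b ^+ 2 * L * M ^+ 2 * q%:R +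
  4 * b * M / K%:R * (g0 + 2 * L * M * b * K%:R)} by eexists.
have E0 : 0 <= E.
  by rewrite defE; nneg.
have term j : (1 <= j < n.+1)%N ->
    - (gamma j * dotp (g (y j)) (G (y j) (s j))) <=
    (if (q < j)%N then gamma j * lagged_bias q j else 0)
    + E + (j <= q)%:R * (2 * b * M * g0 + 4 * (L * M ^+ 2)).
  move=> /andP[j1 jn]; have jK : (j <= K)%N by rewrite (leq_trans _ nK)// ltnW.
  have /andP[gj1 gj2] := gamma_itv j1; have gj0 := gamma_ge0 j1.
  have [qj|jq] := ltnP q j; last first.
    rewrite mul1r add0r; apply: ler_wpDl => //.
    rewrite -mulrN -dotpNl.
    apply: (@le_trans _ _ (2 * b * ((g0 + 2 * L * M * b * K%:R) * M))); last first.
      rewrite [leLHS](_ : _ = 2 * b * M * g0 + 4 * (L * M ^+ 2) * (b ^+ 2 * K%:R));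
        last by ring.
      by rewrite b2K mulr1.
    apply: (@le_trans _ _ (gamma j * ((g0 + 2 * L * M * b * K%:R) * M))).
      rewrite ler_wpM2l//; apply: le_trans (dotp_le _ _) _; rewrite enormN.
      by apply: ler_pM; rewrite ?enorm_ge0// grad_y_le// j1.
    by rewrite ler_wpM2r//; nneg.
  rewrite mul0r addr0.
  apply: (@le_trans _ _ (gamma j * bias j)).
    by rewrite -mulrN ler_wpM2l// /bias dotpBr lerDr dotpvv_ge0.
  have := @bias_le q j; rewrite qj jK => /(_ isT)/(ler_wpM2l gj0)/le_trans; apply.
  rewrite -addrA mulrDr lerD2l.
  apply: (@le_trans _ _ (2 * b * (2 * M / K%:R * (g0 + 2 * L * M * b * K%:R)
      + 8 * b * L * M ^+ 2 * q%:R))).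
    apply: ler_pM => //.
      by nneg.
    rewrite lerD2r ler_wpM2l//; first by nneg.
    by apply: grad_y_le; rewrite subn_gt0 qj (leq_trans (leq_subr _ _)).
  by rewrite le_eqVlt; apply/orP; left; apply/eqP; rewrite defE; ring.
have := f_telescope (ltnW nK).
have := ler_sum_nat term.
rewrite !big_split/= -big_mkcond/= -/S -mulr_suml sum_leq_nat -/t.
rewrite sumr_const_nat subSS subn0 -[E *+ n]mulr_natr.
have nE : E * n%:R <= 16 * (L * M ^+ 2) * q%:R + 4 * b * M * g0 + 8 * (L * M ^+ 2).
  apply: (@le_trans _ _ (E * K%:R)); first by rewrite ler_wpM2l// ler_nat ltnW.
  rewrite defE invK.
  rewrite [leLHS](_ : _ = (16 * (L * M ^+ 2) * q%:R + 4 * b * M * g0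
    + 8 * (L * M ^+ 2) * (b ^+ 2 * K%:R)) * (b ^+ 2 * K%:R)); last by ring.
  by rewrite b2K !mulr1.
have n2 : n%:R * (2 * b ^+ 2 * L * M ^+ 2) <= 2 * (L * M ^+ 2).
  rewrite [leLHS](_ : _ = 2 * (L * M ^+ 2) * (b ^+ 2 * n%:R)); last by ring.
  rewrite -[leRHS]mulr1 ler_wpM2l//; first by nneg.
  by rewrite -[leRHS]b2K ler_wpM2l ?sqr_ge0// ler_nat ltnW.
have yn : f (y n.+1) <=
    f (x n) + b * M * g0 + 2 * (L * M ^+ 2) + b ^+ 2 / 2 * (L * M ^+ 2).
  have D : enorm (y n.+1 - x n) <= b * M.
    have := @y_sub_x n.+1 nK => /le_trans; apply.
    by rewrite ler_piMl//; have := @alpha_itv n.+1 isT; lra.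
  rewrite -(subrK (x n) (y n.+1)) addrC.
  apply: le_trans (descent _ _ df lipg) _.
  have h1 : dotp (g (x n)) (y n.+1 - x n) <= (g0 + 2 * L * M * b * K%:R) * (b * M).
    apply: le_trans (dotp_le _ _) _; apply: ler_pM; rewrite ?enorm_ge0//.
    exact: grad_x_le (ltnW nK).
  have h2 : L / 2 * enorm (y n.+1 - x n) ^+ 2 <= L / 2 * (b * M) ^+ 2.
    rewrite ler_wpM2l// ?divr_ge0// ?(ltW L_gt0)//.
    by rewrite lerXn2r ?nnegrE ?enorm_ge0.
  rewrite (_ : (g0 + _) * _ = b * M * g0 + 2 * (L * M ^+ 2) * (b ^+ 2 * K%:R)) in h1;
    last by ring.
  rewrite b2K mulr1 in h1.
  rewrite (_ : L / 2 * (b * M) ^+ 2 = b ^+ 2 / 2 * (L * M ^+ 2)) in h2; last by field.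
  lra.
(* The coefficient collects [4] from imperfect mixing, [2 t] from the first steps and [1] from
   passing to [y n.+1]. *)
have amgm : (5 + 2 * t) * (b * M) * g0 <=
    f (x 0) - fstar + (b ^+ 2 * (5 + 2 * t) ^+ 2 / 2) * (L * M ^+ 2).
  set Q := (5 + 2 * t) * (b * M).
  have := sqr_ge0 (g0 - L * Q); have := grad_sqr_le (x 0); rewrite -/g0 => h1 h2.
  rewrite -(ler_pM2l (_ : 0 < 2 * L)) ?mulr_gt0//.
  rewrite (_ : 2 * L * (_ + _) = 2 * L * (f (x 0) - fstar) + (L * Q) ^+ 2);
    last by rewrite /Q; field.
  rewrite sqrrB in h2; lra.
have c1 : b ^+ 2 * (5 + 2 * t) ^+ 2 / 2 <= 25 / 4 + 7 * t.
  rewrite [leLHS](_ : _ = 25 / 2 * b ^+ 2 + 10 * t * b ^+ 2 + 2 * t * (b ^+ 2 * t));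
    last by field.
  have := ler_wpM2l t0 b2t; have := ler_wpM2l t0 b22; lra.
have := ler_wpM2r A0 c1; have := ler_wpM2r A0 b22; have := ler_wpM2r A0 tq.
lra.
Qed.

(** * Averaging over the selection probabilities *)

Section Weights.
Context (p : nat -> R) (K_gt0 : (0 < K)%N).
Let w k := gamma k * (1 - L * gamma k).
Let W := \sum_(1 <= j < K.+1) w j.
Context (pE : forall k, (1 <= k <= K)%N -> p k = w k / W).

(** The weight is smallest at [gamma k = b]: on [[b, 2 b]] the difference has the factor
    [1 - L (gamma k + b) >= 1 / 4]. *)
Lemma weight_ge k : (1 <= k)%N -> 3 / 4 * b <= w k.
Proof.
move=> k1; have /andP[g0 g1] := gamma_itv k1.
apply: (@le_trans _ _ (b * (1 - L * b))); first by have := ler_wpM2l (ltW b_gt0) Lb; lra.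
rewrite -subr_ge0 (_ : _ - _ = (gamma k - b) * (1 - L * (gamma k + b)));
  last by rewrite /w; ring.
rewrite mulr_ge0 ?subr_ge0//.
by have := Lb; have := ler_wpM2l (ltW L_gt0) g1; lra.
Qed.

Lemma inv_sum_weight : 0 < W /\ W^-1 <= 4 / 3 * b.
Proof.
have h : K%:R * (3 / 4 * b) <= W.
  rewrite mulr_natl -[X in _ *+ X](subn0) -[X in _ *+ X]subSS -sumr_const_nat.
  by apply: ler_sum_nat => i /andP[i1 _]; exact: weight_ge.
have K0 : 0 < (K%:R : R) by rewrite ltr0n.
have W0 : 0 < W by apply: lt_le_trans h; rewrite !mulr_gt0// divr_gt0.
split=> //; rewrite -[leLHS]mul1r ler_pdivrMr//.
have := ler_wpM2l (ltW b_gt0) h.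
rewrite [leLHS](_ : _ = 3 / 4 * (b ^+ 2 * K%:R)); last by ring.
rewrite b2K; lra.
Qed.

Lemma prob_ge0 k : (1 <= k <= K)%N -> 0 <= p k.
Proof.
move=> kK; rewrite pE// mulr_ge0//; last by rewrite invr_ge0 ltW// inv_sum_weight.1.
by apply: le_trans (weight_ge _); [nneg | case/andP: kK].
Qed.

Lemma sum_prob : \sum_(1 <= k < K.+1) p k = 1.
Proof.
rewrite (eq_big_nat _ _ (F2 := fun k => w k / W)); last by move=> i; exact: pE.
by rewrite -mulr_suml divff// gt_eqF// inv_sum_weight.1.
Qed.

(** The coefficients of the lagged biases after averaging. In the second case the sum is the
    probability that the selected index exceeds [j]. What matters later is that they are
    deterministic and nonnegative. *)
Definition lag_coef j : R :=
  if b <= 2 * L then gamma j / W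
  else 2 * L * gamma j * \sum_(1 <= k < K.+1 | (j < k)%N) p k.

Lemma lag_coef_ge0 j : (1 <= j)%N -> 0 <= lag_coef j.
Proof.
move=> j1; have g0 := gamma_ge0 j1; rewrite /lag_coef; case: ifP => _.
  by rewrite divr_ge0// ltW// inv_sum_weight.1.
rewrite mulr_ge0//; first by nneg.
by rewrite big_nat_cond; apply: sumr_ge0 => i /andP[/prob_ge0].
Qed.

(** For [b <= 2 L], the estimate [p k <= gamma k / W] and [W^-1 <= 4 b / 3] reduce this to
    [large_L_bound], and [24 * 4 / 3 = 32]. Otherwise [grad_sqr_le] and [small_L_bound] apply, and
    the prefactor [2 L] is below [b]. *)
Lemma weighted_bound q :
  \sum_(1 <= k < K.+1) p k * enorm (g (y k)) ^+ 2 <=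
  (8 * L * b ^+ 2 + 2 * b) * (f (x 0) - fstar)
  + b * (L * M ^+ 2 * (22 + 32 * q%:R))
  + \sum_(1 <= j < K.+1 | (q < j)%N) lag_coef j * lagged_bias q j.
Proof.
have delta0 : 0 <= f (x 0) - fstar by rewrite subr_ge0.
set delta := f (x 0) - fstar in delta0 *.
have A0 : 0 <= L * M ^+ 2 by nneg.
have Aq0 : 0 <= L * M ^+ 2 * q%:R by nneg.
have bA := mulr_ge0 (ltW b_gt0) A0; have bAq := mulr_ge0 (ltW b_gt0) Aq0.
have bd := mulr_ge0 (ltW b_gt0) delta0.
have Ld : 0 <= L * b ^+ 2 * delta by nneg.
have [W0 W1] := inv_sum_weight; rewrite /lag_coef.
have [bL|bL] := leP b (2 * L).
  have wi0 : 0 <= W^-1 by rewrite invr_ge0 ltW.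
  apply: (@le_trans _ _ ((\sum_(1 <= k < K.+1) gamma k * enorm (g (y k)) ^+ 2) * W^-1)).
    rewrite mulr_suml; apply: ler_sum_nat => k /andP[k1 kK].
    rewrite pE ?k1// mulrAC ler_wpM2r// ler_wpM2r ?sqr_ge0//.
    rewrite /w ler_piMr ?gamma_ge0// lerBlDr lerDl.
    by rewrite mulr_ge0 ?gamma_ge0// ltW.
  have := ler_wpM2r wi0 (large_L_bound q bL); rewrite -/delta; move/le_trans; apply.
  rewrite mulrDl lerD//; last first.
    rewrite mulr_suml le_eqVlt; apply/orP; left; apply/eqP.
    by apply: eq_bigr => j _; rewrite mulrAC.
  have h : 0 <= delta + L * M ^+ 2 * (10 + 24 * q%:R) by nneg.
  have := ler_wpM2l h W1; lra.
have L0 := L_gt0.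
apply: (@le_trans _ _ (\sum_(1 <= k < K.+1) (p k *
    (2 * L * (2 * delta + L * M ^+ 2 * (19 + 27 * q%:R))) +
    2 * L * (p k * \sum_(1 <= j < k | (q < j)%N) gamma j * lagged_bias q j)))).
  apply: ler_sum_nat => k /andP[k1 kK].
  have kK' : (1 <= k <= K)%N by rewrite k1.
  rewrite [X in _ + X]mulrCA -mulrDr ler_wpM2l ?prob_ge0// -mulrDr.
  apply: le_trans (grad_sqr_le _) _; rewrite ler_wpM2l//; first by nneg.
  exact: small_L_bound.
rewrite big_split/= -mulr_suml sum_prob mul1r lerD//.
  have h : 0 <= 2 * delta + L * M ^+ 2 * (19 + 27 * q%:R) by nneg.
  have := ler_wpM2r h (ltW bL); lra.
rewrite -mulr_sumr le_eqVlt; apply/orP; left; apply/eqP.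
(* Exchanging the two sums gathers, for each [j], the probabilities of all [k > j]. *)
under eq_big_nat => k /andP[k1 kK].
  rewrite (@big_nat_widen _ _ _ _ _ K.+1); last exact: ltnW.
  rewrite big_mkcondr mulr_sumr.
  over.
rewrite exchange_big_nat/= mulr_sumr; apply: eq_bigr => j _.
rewrite (big_mkcond (fun k => (j < k)%N))/= [RHS]mulrAC !mulr_sumr; apply: eq_bigr => k _.
by case: ifP => _; ring.
Qed.

End Weights.
End Iteration.

(** * Measurability and the Markov property *)

(** An open set is a countable union of sup-norm boxes with rational centres and radii
    [1 / (n + 1)], and the preimage of a box is a finite intersection of coordinate events. *)
Lemma measurable_continuous_comp (R : realType) (d : nat) (disp : measure_display)
    (S : measurableType disp) (v : S -> 'rV[R]_d) (phi : 'rV[R]_d -> R) :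
  (forall i, measurable_fun setT (fun w => v w 0 i)) -> continuous phi ->
  measurable_fun setT (phi \o v).
Proof.
move=> mv cphi mT; apply: (measurability _ (RGenOInfty.measurableE R)) => //.
move=> /= _ [_ [a ->] <-]; rewrite setTI.
pose U := phi @^-1` `]a, +oo[.
have oU : open U by apply: open_comp; [move=> ? _; exact: cphi|exact: interval_open].
pose box (c : 'rV[rat]_d * nat) : set 'rV[R]_d :=
  [set z | forall i, `|z 0 i - ratr (c.1 0 i)| < c.2.+1%:R^-1].
have -> : (phi \o v) @^-1` `]a, +oo[ = \bigcup_c [set w | box c `<=` U /\ box c (v w)].
  apply/seteqP; split=> [w Uw|w [c _ /= [cU wc]]]; last exact: cU.
  have /nbhs_ballP[e e0 eU] : nbhs (v w) U by exact: open_nbhs_nbhs.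
  (* The factor 2 allows the rational centre to be off [v w] by a full box radius. *)
  have [n ne] : exists n, 2 * n.+1%:R^-1 < e :> R.
    have [n _ ne] := @near_infty_natSinv_lt R (PosNum (divr_gt0 e0 (@ltr0n R 2))).
    by exists n; have := ne n (leqnn n); rewrite /= ltr_pdivlMr// mulrC.
  have n0 : 0 < n.+1%:R^-1 :> R by rewrite invr_gt0.
  have /choice[q qP] : forall i, exists q : rat, `|v w 0 i - ratr q| < n.+1%:R^-1 :> R.
    move=> i; have : v w 0 i - n.+1%:R^-1 < v w 0 i + n.+1%:R^-1.
      by rewrite ltrD2l gt0_cp.
    move=> /rat_in_itvoo[q]; rewrite in_itv/= => /andP[q1 q2]; exists q.
    by rewrite ltr_distlC q1 q2.
  exists (\row_i q i, n) => //=; split=> [z /= zb|i /=]; last by rewrite mxE.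
  apply: eU; split=> // i j; rewrite (ord1 i) /ball/=.
  have := zb j; have := qP j; rewrite mxE => h1 h2.
  rewrite distrC in h2; apply: le_lt_trans (ler_distD (ratr (q j)) _ _) _.
  by apply: lt_trans ne; rewrite mulr_natl mulr2n ltrD.
apply: countable_bigcupT_measurable => // c.
have [cU|cU] := pselect (box c `<=` U); last first.
  by rewrite (_ : mkset _ = set0)//; apply/seteqP; split=> // w [].
have -> : [set w | box c `<=` U /\ box c (v w)] = \bigcap_(i in [set: 'I_d])
    (fun w => v w 0 i) @^-1` ball (ratr (c.1 0 i) : R) c.2.+1%:R^-1.
  apply/seteqP; split=> [w [_ wc] i _|w wc].
    by rewrite /= /ball/= distrC; exact: wc.
  by split=> // i; have := wc i I; rewrite /= /ball/= distrC.
rewrite -[X in measurable X]setCK setC_bigcap; apply: measurableC.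
apply: fin_bigcup_measurable => // i _; apply: measurableC.
rewrite -[X in measurable X]setTI.
by apply: mv => //; exact: measurable_ball.
Qed.

(** * Integrals of functions measurable for a coarser sigma-algebra *)

Section SubSigma.
Local Open Scope ereal_scope.
Context {disp : measure_display} {Omega : measurableType disp} {R : realType}.
Implicit Types P mu : {measure set Omega -> \bar R}.

Lemma ge0_integral_mrestr mu (B : set Omega) (mB : measurable B)
    (h : Omega -> \bar R) :
  measurable_fun setT h -> (forall w, 0 <= h w) ->
  \int[mrestr mu mB]_w h w = \int[mu]_(w in B) h w.
Proof.
move=> mh h0.
have mC := measurableC mB.
rewrite -[in LHS](setUv B) ge0_integral_setU//=; last 2 first.
  by apply: measurable_funS mh.
  by apply/disj_setPS => w [].
rewrite [X in _ + X]null_set_integral ?adde0//; last 2 first.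
  by apply: measurable_funS mh.
  by rewrite /= /mrestr setICl measure0.
apply: eq_measure_integral => A mA AB.
by rewrite /= /mrestr setIidl.
Qed.

(** The restrictions of [P] to [B] and to [B'], pushed to the coarser sigma-algebra by the identity,
    are proportional measures. This carries both the Markov property and the independence of the
    index from events to integrals. *)
Lemma ge0_integral_sub_sigma P (GG : set_system Omega) (B B' : set Omega) (c : R)
    (h : Omega -> \bar R) :
  <<s GG >> `<=` measurable -> measurable B -> measurable B' -> (0 <= c)%R ->
  (forall A, <<s GG >> A -> P (A `&` B) = P (A `&` B') * c%:E) ->
  measurable_fun [set: g_sigma_algebraType GG] h -> (forall w, 0 <= h w) ->
  \int[P]_(w in B) h w = c%:E * \int[P]_(w in B') h w.
Proof.
move=> sub mB mB' c0 PE mh h0.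
pose i : Omega -> g_sigma_algebraType GG := idfun.
have mi : measurable_fun setT i by move=> _ A mA; rewrite setTI; exact: sub.
have mh' : measurable_fun [set: Omega] h by exact: (measurableT_comp mh mi).
have push D (mD : measurable D) : \int[P]_(w in D) h w =
    \int[pushforward (mrestr P mD) i]_w h w.
  rewrite -ge0_integral_mrestr//.
  by rewrite (ge0_integral_pushforward mi)//= preimage_setT.
rewrite (push _ mB) (push _ mB').
rewrite -(ge0_integral_mscale _ _ (NngNum c0))//=.
apply: eq_measure_integral => A mA _.
by rewrite /= /mscale /= /pushforward /mrestr/= muleC; exact: PE.
Qed.

Lemma ge0_integral_partition (I : finType) mu (D : set Omega) (xi : Omega -> I)
    (h : Omega -> \bar R) :
  measurable D -> (forall s, measurable [set w | xi w = s]) ->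
  measurable_fun setT h -> (forall w, 0 <= h w) ->
  \int[mu]_(w in D) h w = \sum_(s : I) \int[mu]_(w in D `&` [set w | xi w = s]) h w.
Proof.
move=> mD mxi mh h0.
have DE : D = \big[setU/set0]_(s <- enum I) (D `&` [set w | xi w = s]).
  rewrite -bigcup_seq; apply/seteqP; split=> [w Dw|w [s _ []]//].
  by exists (xi w) => //=; rewrite mem_enum.
rewrite [in LHS]DE ge0_integral_bigsetU ?enum_uniq ?big_enum//=.
- by move=> s; exact: measurableI.
- by move=> s t _ _ [w [[_ <-] [_ <-]]].
- exact: measurable_funS mh.
Qed.

End SubSigma.

Lemma measurable_fun_cases (R : realType) (I : finType) (disp : measure_display)
    (S : measurableType disp) (xi : S -> I) (F : I -> S -> R) :
  (forall s, measurable [set w | xi w = s]) ->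
  (forall s, measurable_fun setT (F s)) ->
  measurable_fun setT (fun w => F (xi w) w).
Proof.
move=> mxi mF.
rewrite (_ : (fun _ => _) = fun w => \sum_s \1_[set w | xi w = s] w * F s w).
  by apply: measurable_sum => s; apply: measurable_funM => //; exact: measurable_indic.
apply/funext => w; rewrite (bigD1 (xi w))//= indicE mem_set// mul1r.
rewrite big1 ?addr0// => s /eqP sw; rewrite indicE memNset ?mul0r//=.
exact/nesym.
Qed.

(** On [A], where [nu <= mu], the sum is [mu A - nu A]; equal total masses give the same value on
    the complement. *)
Lemma sum_abs_le_tv (R : realType) (I : finType) (mu nu : I -> R) :
  \sum_s mu s = \sum_s nu s -> \sum_s `|mu s - nu s| <= 2 * tv_dist mu nu.
Proof.
move=> munu; have bnd (A : {set I}) :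
    `|\sum_(s in A) mu s - \sum_(s in A) nu s| <= tv_dist mu nu.
  exact: (le_bigmax _ (fun A : {set I} => `|\sum_(s in A) mu s - \sum_(s in A) nu s|)).
pose A := [set s | nu s <= mu s]%SET.
have HC F : \sum_s F s = \sum_(s in A) F s + \sum_(s in ~: A) F s :> R.
  rewrite (bigID (fun s => s \in A)); congr (_ + _).
  by apply: eq_bigl => s; rewrite finset.in_setC.
have E : \sum_(s in A) mu s - \sum_(s in A) nu s =
    \sum_(s in ~: A) nu s - \sum_(s in ~: A) mu s.
  by move: munu; rewrite !HC; lra.
rewrite mulr_natl mulr2n HC lerD//; apply: le_trans (bnd A).
  rewrite -sumrB (eq_bigr (fun s => mu s - nu s)) ?ler_norm// => s.
  by rewrite inE => h; rewrite ger0_norm ?subr_ge0.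
rewrite E -sumrB (eq_bigr (fun s => nu s - mu s)) ?ler_norm// => s.
by rewrite !inE -ltNge => h; rewrite distrC gtr0_norm ?subr_gt0.
Qed.

(** * Multi-step Markov property, measurability of the iterates, random index *)

Section Chain.
Context {R : realType} {d : nat} {Xi : finType}.
Context {disp : measure_display} {Omega : measurableType disp}.
Context (P : probability Omega R) (x0 xb0 : Omega -> 'rV[R]_d).
Context (T : Xi -> Xi -> R) (xi : nat -> Omega -> Xi).
Context (mx0 : random_vector x0) (mxb0 : random_vector xb0).
Context (xiP : markov_chain P x0 xb0 T xi) (stT : stochastic T).

Local Notation hist J := (history x0 xb0 xi J).
Local Notation gens J := (coord_events x0 `|` coord_events xb0 `|`
      [set A | exists (j : nat) (s : Xi), J j /\ A = [set w | xi j w = s]]).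

Lemma history_measurable J : hist J `<=` measurable.
Proof.
apply: smallest_sub; first exact: sigma_algebra_measurable.
move=> A [[|]|].
- by move=> [i [B [mB ->]]]; rewrite -[X in measurable X]setTI; exact: mx0.
- by move=> [i [B [mB ->]]]; rewrite -[X in measurable X]setTI; exact: mxb0.
- by move=> [j [s [_ ->]]]; exact: xiP.1.
Qed.

Lemma historyS (J J' : set nat) : J `<=` J' -> hist J `<=` hist J'.
Proof.
move=> JJ'; apply: sub_sigma_algebra2 => A [?|[j [s [Jj ->]]]]; [by left|right].
by exists j, s; split=> //; exact: JJ'.
Qed.

Lemma history_xi (J : set nat) j s : J j -> hist J [set w | xi j w = s].
Proof. by move=> Jj; apply: sub_sigma_algebra; right; exists j, s. Qed.

Lemma historyI J A B : hist J A -> hist J B -> hist J (A `&` B).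
Proof. exact: (@measurableI _ (g_sigma_algebraType (gens J))). Qed.

Lemma kstep_ge0 m s t : 0 <= kstep T m s t.
Proof.
elim: m s => [|m IH] s /=; first by case: eqP.
by apply: sumr_ge0 => u _; rewrite mulr_ge0//; exact: (stT s).1.
Qed.

(** Induction on [m], splitting on the next state [u]; the event [xi k = s] is absorbed into the
    history at time [k.+1]. *)
Lemma markov_kstep m k A s t : hist [set j | (j <= k)%N] A ->
  (P (A `&` [set w | xi k w = s] `&` [set w | xi (k + m)%N w = t]) =
   P (A `&` [set w | xi k w = s]) * (kstep T m s t)%:E)%E.
Proof.
elim: m k A s => [|m IH] k A s hA /=.
  rewrite addn0; case: eqP => [<-|st]; first by rewrite mule1 -setIA setIid.
  rewrite mule0 (_ : _ `&` _ = set0) ?measure0//.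
  by apply/seteqP; split=> // w [[_ /= ->]].
have hA' : hist [set j | (j <= k.+1)%N] (A `&` [set w | xi k w = s]).
  apply: historyI; last by apply: history_xi; exact: leqnSn.
  by apply: historyS hA => j /= /leqW.
have mA := history_measurable hA'.
have mxi j u : measurable [set w | xi j w = u] by exact: xiP.1.
have -> : P (A `&` [set w | xi k w = s] `&` [set w | xi (k + m.+1)%N w = t]) =
    (\sum_(u : Xi) P (A `&` [set w | xi k w = s] `&` [set w | xi k.+1 w = u]
       `&` [set w | xi (k + m.+1)%N w = t]))%E.
  have mB : measurable (A `&` [set w | xi k w = s] `&` [set w | xi (k + m.+1)%N w = t]).
    exact: measurableI.
  have := @ge0_integral_partition _ _ R Xi P _ (xi k.+1) (cst 1%E)
    mB (mxi _) (measurable_cst _) (fun=> lee01).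
  rewrite integral_cst// mul1e => ->; apply: eq_bigr => u _.
  rewrite integral_cst ?mul1e; last exact: measurableI.
  by congr (P _); rewrite -!setIA; congr (_ `&` (_ `&` _)); rewrite setIC.
rewrite -sumEFin ge0_sume_distrr; last first.
  by move=> u _; rewrite lee_fin mulr_ge0 ?kstep_ge0//; exact: (stT s).1.
apply: eq_bigr => u _.
by rewrite addnS -addSn IH// xiP.2// -muleA -EFinM.
Qed.

Local Notation histType J := (g_sigma_algebraType (gens J)).

Lemma history_measurable_fun J d' (S : measurableType d') (h : Omega -> S) :
  measurable_fun [set: histType J] h -> measurable_fun [set: Omega] h.
Proof.
move=> mh _ B mB; rewrite setTI; apply: (@history_measurable J).
by have := mh measurableT B mB; rewrite setTI.
Qed.

(** This stands in for conditional expectation: [h t] is determined by the history up to [k], and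
    given that history and [xi k = s], the state [m] steps later has law [kstep T m s]. *)
Lemma markov_integral_le m k (h : Xi -> Omega -> R) (c : R) :
  (forall t, measurable_fun [set: histType [set j | (j <= k)%N]] (h t)) ->
  (forall t w, 0 <= h t w) ->
  (forall s w, \sum_t kstep T m s t * h t w <= c) ->
  (\int[P]_w (h (xi (k + m)%N w) w)%:E <= c%:E)%E.
Proof.
move=> mh h0 hc.
have mxi j s : measurable [set w | xi j w = s] by exact: xiP.1.
have mh' t := history_measurable_fun (mh t).
have mH : measurable_fun setT (fun w => (h (xi (k + m)%N w) w)%:E).
  by apply/measurable_EFinP; exact: measurable_fun_cases.
rewrite (ge0_integral_partition _ _ (mxi k))//; last by move=> w; rewrite lee_fin.
have -> : c%:E = (\sum_s \int[P]_(w in setT `&` [set w | xi k w = s]) (cst c%:E w))%E.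
  rewrite -(ge0_integral_partition _ _ (mxi k))//.
    rewrite integral_cst// -[LHS]mule1; congr (_ * _)%E.
    exact/esym/(@probability_setT _ _ _ P).
  move=> w; rewrite lee_fin (le_trans _ (hc (xi 0%N w) w))//.
  by apply: sumr_ge0 => t _; rewrite mulr_ge0// kstep_ge0.
apply: lee_sum => s _; rewrite setTI.
rewrite (ge0_integral_partition _ _ (mxi (k + m)%N))//; last by move=> w; rewrite lee_fin.
have step t : (\int[P]_(w in [set w | xi k w = s] `&` [set w | xi (k + m)%N w = t])
     (h (xi (k + m)%N w) w)%:E =
     \int[P]_(w in [set w | xi k w = s]) (kstep T m s t * h t w)%:E)%E.
  rewrite (eq_integral (fun w => (h t w)%:E)); last first.
    by move=> w; rewrite inE => -[_ /= ->].
  under [RHS]eq_integral do rewrite EFinM.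
  rewrite ge0_integralZl_EFin//; [|by move=> w _; rewrite lee_fin|
    by apply/measurable_EFinP; apply: measurable_funS (mh' t)|exact: kstep_ge0].
  apply: (@ge0_integral_sub_sigma _ _ _ P (gens [set j | (j <= k)%N])) => //.
  - exact: history_measurable.
  - exact: measurableI.
  - exact: kstep_ge0.
  - by move=> A hA; rewrite setIA; exact: markov_kstep.
  - by apply/measurable_EFinP; exact: mh.
  - by move=> w; rewrite lee_fin.
under eq_bigr do rewrite step.
rewrite -ge0_integral_sum//; last 2 first.
  move=> t; apply/measurable_EFinP; apply: measurable_funM => //.
  exact: measurable_funS (mh' t).
  by move=> t w _; rewrite lee_fin mulr_ge0// kstep_ge0.
apply: ge0_le_integral => //.
- by move=> w _; apply: sume_ge0 => t _; rewrite lee_fin mulr_ge0// kstep_ge0.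
- apply: emeasurable_sum => t; apply/measurable_EFinP; apply: measurable_funM => //.
  exact: measurable_funS (mh' t).
- by move=> w _; rewrite sumEFin lee_fin.
Qed.

Context (G : 'rV[R]_d -> Xi -> 'rV[R]_d) (K : nat).
Context (cG : forall s i, continuous (fun z => G z s 0 i)).
Context (alpha beta gamma : nat -> R) (x xb y : nat -> Omega -> 'rV[R]_d).
Context (x0E : x 0%N = x0) (xb0E : xb 0%N = xb0).
Context (algP : accelerated_mgd G alpha beta gamma xi K x xb y).

Local Notation coord_measurable J v :=
  (forall i, measurable_fun [set: histType J] (fun w => v w 0 i)).

Let y_measurable J k : (1 <= k <= K)%N ->
  coord_measurable J (x k.-1) -> coord_measurable J (xb k.-1) ->
  coord_measurable J (y k).
Proof.
move=> kK mx mxb i.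
rewrite (_ : (fun _ => _) = fun w => (1 - alpha k) * xb k.-1 w 0 i
    + alpha k * x k.-1 w 0 i); last first.
  by apply/funext => w; have [-> _ _] := algP w kK; rewrite !mxE.
by apply: measurable_funD; apply: measurable_funM.
Qed.

(** [J] is arbitrary, so that one statement covers both the history up to a given time and the full
    history. *)
Lemma iterate_measurable J n : (n <= K)%N ->
  (forall j, (1 <= j <= n)%N -> J j) ->
  coord_measurable J (x n) /\ coord_measurable J (xb n).
Proof.
elim: n => [|n IH] nK nJ.
  by split=> i _ B mB; rewrite setTI; apply: sub_sigma_algebra; left;
    [left|right]; exists i, B; rewrite ?x0E ?xb0E.
have [j /andP[j1 jn]|mx mxb] := IH (ltnW nK).
  by apply: nJ; rewrite j1 ltnW.
have nK' : (1 <= n.+1 <= K)%N by [].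
have my := y_measurable nK' mx mxb.
have mG i : measurable_fun [set: histType J] (fun w => G (y n.+1 w) (xi n.+1 w) 0 i).
  apply: (@measurable_fun_cases _ _ _ (histType J) (xi n.+1)
    (fun s w => G (y n.+1 w) s 0 i)) => s.
    by apply: history_xi; apply: nJ; rewrite leqnn.
  exact: (@measurable_continuous_comp _ _ _ (histType J) (y n.+1) _ my (@cG s i)).
split=> i.
  rewrite (_ : (fun _ => _) = fun w =>
      x n w 0 i - gamma n.+1 * G (y n.+1 w) (xi n.+1 w) 0 i).
    by apply: measurable_funB => //; apply: measurable_funM.
  by apply/funext => w; have [_ -> _] := algP w nK'; rewrite !mxE.
rewrite (_ : (fun _ => _) = fun w =>
    y n.+1 w 0 i - beta n.+1 * G (y n.+1 w) (xi n.+1 w) 0 i).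
  by apply: measurable_funB => //; apply: measurable_funM.
by apply/funext => w; have [_ _ ->] := algP w nK'; rewrite !mxE.
Qed.

(** The inequality [j < k] is strict: the query point is fixed before its own sample is drawn. *)
Lemma query_measurable J k : (1 <= k <= K)%N ->
  (forall j, (1 <= j < k)%N -> J j) -> coord_measurable J (y k).
Proof.
case: k => // k kK kJ.
by have [|mx mxb] := @iterate_measurable J k (ltnW kK); last exact: y_measurable.
Qed.

(** Split by the value of [rho]; independence from the full history turns each event [rho = k] into
    the factor [p k]. *)
Lemma random_index_integral (p : nat -> R) (rho : Omega -> nat) (u : nat -> Omega -> R) :
  random_index P x0 xb0 xi K p rho ->
  (forall k, (1 <= k <= K)%N -> 0 <= p k) ->
  (forall k, (1 <= k <= K)%N -> measurable_fun [set: histType setT] (u k)) ->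
  (forall k w, 0 <= u k w) ->
  (\int[P]_w (u (rho w) w)%:E =
   \int[P]_w (\sum_(1 <= k < K.+1) p k * u k w)%:E)%E.
Proof.
move=> [rhoK mrho Prho indep] p0 mu u0.
have mrho' (i : 'I_K.+1) : measurable [set w | inord (rho w) = i].
  rewrite (_ : [set w | _] = [set w | rho w = i])//; apply/seteqP; split=> w /=.
    by move=> <-; rewrite inordK// ltnS; case/andP: (rhoK w).
  by move=> ->; rewrite inord_val.
have mu' k kK := history_measurable_fun (mu k kK).
(* The ordinal [0] is never a value of [rho]; it gets the default value zero. *)
pose u' (i : 'I_K.+1) := if (0 < i)%N then u i else cst 0.
have uE w : u (rho w) w = u' (inord (rho w)) w.
  have /andP[r1 r2] := rhoK w.
  by rewrite /u' inordK ?ltnS// r1.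
have mu'' i : measurable_fun [set: Omega] (u' i).
  rewrite /u'; case: ifP => i0; last exact: measurable_cst.
  by apply: mu'; rewrite i0 -ltnS ltn_ord.
have mU : measurable_fun setT (fun w => (u (rho w) w)%:E).
  apply/measurable_EFinP; rewrite (_ : (fun _ => _) = fun w => u' (inord (rho w)) w);
    last by apply/funext => w; rewrite uE.
  exact: (@measurable_fun_cases _ _ _ _ (fun w => inord (rho w)) u').
rewrite (ge0_integral_partition _ measurableT mrho' mU); last first.
  by move=> w; rewrite lee_fin.
have pu0 (i : 'I_K.+1) w : 0 <= p i * u' i w.
  rewrite /u'; case: (posnP i) => [->|i0]; first by rewrite mulr0.
  by rewrite mulr_ge0 ?p0// i0 -ltnS ltn_ord.
rewrite (_ : (fun w => (\sum_(1 <= k < K.+1) p k * u k w)%:E) =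
    fun w => (\sum_(i < K.+1) (p i * u' i w)%:E)%E); last first.
  apply/funext => w; rewrite sumEFin big_add1 big_mkord big_ord_recl/= {1}/u' mulr0 add0r.
  by congr (_%:E); apply: eq_bigr => i _; rewrite /u' lift0.
rewrite ge0_integral_sum//; last 2 first.
  by move=> i; apply/measurable_EFinP; exact: measurable_funM.
  by move=> i w _; rewrite lee_fin.
apply: eq_bigr => i _; rewrite setTI.
rewrite (eq_integral (fun w => (u' i w)%:E)); last first.
  by move=> w; rewrite inE/= => <-; rewrite uE.
rewrite /u'; case: (posnP i) => [i0|i0].
  by under [RHS]eq_integral do rewrite mulr0; rewrite !integral0.
have iK : (1 <= i <= K)%N by rewrite i0 -ltnS ltn_ord.
under [RHS]eq_integral do rewrite EFinM.
rewrite ge0_integralZl_EFin//; [|by move=> w _; rewrite lee_fin|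
  by apply/measurable_EFinP; exact: mu'|exact: p0].
apply: (@ge0_integral_sub_sigma _ _ _ P (gens setT)) => //.
- exact: history_measurable.
- exact: p0.
- move=> A hA; rewrite (_ : [set w | _] = [set w | rho w = i]).
    by have := indep i A hA; rewrite Prho// setIT.
  apply/seteqP; split=> w /=; last by move=> ->; rewrite inord_val.
  by move=> <-; rewrite inordK// ltnS; case/andP: (rhoK w).
- by apply/measurable_EFinP; exact: mu.
- by move=> w; rewrite lee_fin.
Qed.

End Chain.

(** * Continuity, the gradient of the mean objective, and the bias under a nearly mixed law *)

Lemma lipschitz_enorm_continuous (R : realType) (d : nat) (phi : 'rV[R]_d -> R)
    (L : R) : 0 <= L ->
  (forall x z, `|phi x - phi z| <= L * enorm (x - z)) -> continuous phi.
Proof.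
move=> L0 lip x A /nbhs_ballP[e /= e0 eA].
(* The summand 1 keeps the divisor positive when [L] or [d] is zero. *)
have c0 : 0 < L * d%:R + 1 by rewrite ltr_wpDl// mulr_ge0.
pose r := e / (L * d%:R + 1); have r0 : 0 < r by exact: divr_gt0.
apply/nbhs_ballP; exists r => //= z [_ xz]; apply: eA; rewrite /ball/=.
apply: le_lt_trans (lip _ _) _.
apply: (@le_lt_trans _ _ (L * (d%:R * r))).
  rewrite ler_wpM2l// enorm_le_coord// => i.
  by rewrite !mxE; exact/ltW/xz.
rewrite mulrA; apply: (@lt_le_trans _ _ ((L * d%:R + 1) * r)).
  by rewrite ltr_pM2r// ltrDl.
by rewrite /r mulrC divfK ?gt_eqF.
Qed.

Lemma is_gradient_mean_obj (R : realType) (d : nat) (Xi : finType) (pi : Xi -> R)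
    (F : 'rV[R]_d -> Xi -> R) (G : 'rV[R]_d -> Xi -> 'rV[R]_d) (x : 'rV[R]_d) :
  (forall s, is_gradient (fun z => F z s) x (G x s)) ->
  is_gradient (mean_obj pi F) x (\sum_s pi s *: G x s).
Proof.
move=> dF.
have -> : mean_obj pi F = \sum_s (pi s *: (fun z => F z s)).
  by apply/funext => z; rewrite fct_sumE.
split.
  elim/big_ind : _ => [|h1 h2 d1 d2|s _].
  - exact: differentiable_cst.
  - exact: differentiableD.
  - by apply: differentiableZ; exact: (dF s).1.
apply/rowP => i; rewrite mxE summxE.
have -> : \sum_s (pi s *: G x s) 0 i =
    \sum_s pi s *: 'D_(delta_mx 0 i) (fun z => F z s) x.
  by apply: eq_bigr => s _; rewrite mxE (dF s).2 mxE.
apply/esym/derive_val.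
elim/big_ind2 : _ => [|h1 a1 h2 a2 d1 d2|s _].
- exact: is_derive_cst.
- exact: is_deriveD.
- by apply: is_deriveZ; apply/derivableP/diff_derivable; exact: (dF s).1.
Qed.

Lemma kstep_sum1 (R : realType) (Xi : finType) (T : Xi -> Xi -> R) m s :
  stochastic T -> \sum_t kstep T m s t = 1.
Proof.
move=> stT; elim: m s => [|m IH] s /=.
  rewrite (bigD1 s)//= eqxx big1 ?addr0// => t ts.
  by rewrite eq_sym (negbTE ts).
rewrite exchange_big/= -[RHS](stT s).2; apply: eq_bigr => u _.
by rewrite -mulr_sumr IH mulr1.
Qed.

(** The bias vanishes under [pi], so only the difference [pi - mu] contributes. The factor [enorm u]
    is kept, not replaced by [M], for the case of small [L]. *)
Lemma mixed_bias_le (R : realType) (d : nat) (Xi : finType) (mu pi : Xi -> R)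
    (v : Xi -> 'rV[R]_d) (u : 'rV[R]_d) (M e : R) :
  is_dist mu -> is_dist pi -> u = \sum_t pi t *: v t ->
  (forall t, enorm (v t) <= M) -> 0 <= M -> tv_dist mu pi <= e ->
  \sum_t mu t * dotp u (u - v t) <= 2 * M * e * enorm u.
Proof.
move=> [mu0 mu1] [pi0 pi1] uE vM M0 tve.
have uu : dotp u u = \sum_t pi t * dotp u (v t).
  by rewrite {2}uE dotp_sumr; apply: eq_bigr => t _; rewrite dotpZr.
have -> : \sum_t mu t * dotp u (u - v t) = \sum_t (pi t - mu t) * dotp u (v t).
  under eq_bigr do rewrite dotpBr mulrBr.
  under [RHS]eq_bigr do rewrite mulrBl.
  by rewrite !sumrB -mulr_suml mu1 mul1r uu.
apply: (@le_trans _ _ (\sum_t `|mu t - pi t| * (enorm u * M))).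
  apply: ler_sum => t _; apply: le_trans (ler_norm _) _.
  rewrite normrM distrC ler_wpM2l//; apply: le_trans (normr_dotp_le _ _) _.
  by rewrite ler_wpM2l ?enorm_ge0.
rewrite -mulr_suml; apply: (@le_trans _ _ (2 * e * (enorm u * M))).
  rewrite ler_wpM2r ?mulr_ge0 ?enorm_ge0//.
  apply: le_trans (sum_abs_le_tv _) _; first by rewrite mu1 pi1.
  by rewrite ler_wpM2l.
by rewrite le_eqVlt; apply/orP; left; apply/eqP; ring.
Qed.

(** * Expectations that may be infinite *)

Section Expectation.
Local Open Scope ereal_scope.
Context {disp : measure_display} {Omega : measurableType disp} {R : realType}.
Context (P : probability Omega R).

(** The negative part of [h] is bounded, hence has a finite integral, so the subtraction is
    legitimate even if the integral of [h] is infinite. *)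
Lemma integral_sub_lbound (h : Omega -> R) (c : R) :
  measurable_fun setT h -> (forall w, (c <= h w)%R) ->
  \int[P]_w (h w - c)%:E = \int[P]_w (h w)%:E - c%:E.
Proof.
move=> mh hc; rewrite [X in _ = X - _]integralE.
set a := _ ^\+; set b := _ ^\-.
pose cp : R := Num.max c 0%R; pose cm : R := Num.max (- c)%R 0%R.
have mhE : measurable_fun setT (fun w => (h w)%:E) by exact/measurable_EFinP.
have ma : measurable_fun setT a by exact: measurable_funepos.
have mb : measurable_fun setT b by exact: measurable_funeneg.
have a_ge0 w : 0 <= a w by exact: funepos_ge0.
have b_ge0 w : 0 <= b w by exact: funeneg_ge0.
have cp0 : (0 <= cp)%R by rewrite le_max lexx orbT.
have cm0 : (0 <= cm)%R by rewrite le_max lexx orbT.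
have cE : c = (cp - cm)%R.
  rewrite /cp /cm; case: (leP c 0%R) => h1; case: (leP (- c)%R 0%R) => h2; lra.
have md : measurable_fun setT (fun w => (h w - c)%:E).
  by apply/measurable_EFinP; exact: measurable_funB.
(* With [c] also split into positive and negative parts, all summands are nonnegative and integrate
   additively. *)
have E w : a w + cm%:E = (h w - c)%:E + (cp%:E + b w).
  rewrite /a /b funeposE funenegE -EFinN -!EFin_max -!EFinD; congr (_%:E).
  rewrite [in RHS]cE; case: (leP (h w) 0%R) => h1; case: (leP (- h w)%R 0%R) => h2; lra.
have int_cst (v : R) : \int[P]_w v%:E = v%:E.
  by rewrite (integral_cst P measurableT) [X in _ * X]probability_setT mule1.
have EI : \int[P]_w a w + cm%:E = \int[P]_w (h w - c)%:E + (cp%:E + \int[P]_w b w).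
  have I1 : \int[P]_w (a w + cm%:E) = \int[P]_w a w + cm%:E.
    by rewrite ge0_integralD//; congr (_ + _); exact: int_cst.
  have I2 : \int[P]_w (cp%:E + b w) = cp%:E + \int[P]_w b w.
    by rewrite ge0_integralD//; congr (_ + _); exact: int_cst.
  rewrite -I1 -I2 -ge0_integralD//=.
  - by apply: eq_integral => w _; rewrite E.
  - by move=> w _; rewrite lee_fin subr_ge0.
  - by move=> w _; rewrite adde_ge0.
  - exact: emeasurable_funD.
have b_le : \int[P]_w b w <= cm%:E.
  rewrite -(int_cst cm); apply: ge0_le_integral => // w _.
  rewrite /b funenegE -EFinN -EFin_max lee_fin ge_max cm0 andbT le_max.
  by rewrite lerN2 hc.
have b0 : 0 <= \int[P]_w b w by exact: integral_ge0.
have a0 : 0 <= \int[P]_w a w by exact: integral_ge0.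
have d0 : 0 <= \int[P]_w (h w - c)%:E.
  by apply: integral_ge0 => w _; rewrite lee_fin subr_ge0.
move: b_le b0 a0 d0 EI.
case: (\int[P]_w b w) => [b'||] //; case: (\int[P]_w a w) => [a'||] //;
  case: (\int[P]_w (h w - c)%:E) => [d'||] //.
by move=> _ _ _ _ [] AE; congr (_%:E); rewrite cE; lra.
Qed.

(** Each [Z j] is shifted by [Z0] to become nonnegative. The shifts add the finite constant [C0] to
    both sides, which cancels after integration; [delta] may have an infinite integral. *)
Lemma integral_le_of_drift (u delta : Omega -> R) (r : seq nat) (Q : pred nat)
    (A B Z0 : R)
    (c : nat -> R) (Z : nat -> Omega -> R) :
  measurable_fun setT u -> measurable_fun setT delta ->
  (forall j, (j \in r) && Q j -> measurable_fun setT (Z j)) ->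
  (forall w, (0 <= u w)%R) -> (forall w, (0 <= delta w)%R) ->
  (0 <= A)%R -> (0 <= B)%R -> (0 <= Z0)%R ->
  (forall j, (j \in r) && Q j -> (0 <= c j)%R) ->
  (forall j w, (j \in r) && Q j -> (0 <= Z j w + Z0)%R) ->
  (forall j, (j \in r) && Q j -> \int[P]_w (Z j w + Z0)%:E <= Z0%:E) ->
  (forall w, (u w <= A * delta w + B + \sum_(j <- r | Q j) c j * Z j w)%R) ->
  \int[P]_w (u w)%:E <= A%:E * \int[P]_w (delta w)%:E + B%:E.
Proof.
move=> mu md mZ u0 d0 A0 B0 Z00 c0 ZZ0 EZ hu.
pose I j := (j \in r) && Q j.
pose C0 : R := (\sum_(j <- r) (if I j then c j * Z0 else 0))%R.
have int_cst (v : R) : \int[P]_w v%:E = v%:E.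
  by rewrite (integral_cst P measurableT) [X in _ * X]probability_setT mule1.
pose V j w := (if I j then c j * (Z j w + Z0) else 0)%R.
have mV j : measurable_fun setT (V j).
  rewrite /V; case jr : (I j) => //.
  by apply: measurable_funM => //; apply: measurable_funD => //; exact: mZ.
have V0 j w : (0 <= V j w)%R.
  by rewrite /V; case: ifP => // jr; rewrite mulr_ge0 ?c0 ?ZZ0.
pose SV w := (\sum_(j <- r) V j w)%R.
have mSV : measurable_fun setT SV by exact: measurable_sum.
have SV0 w : (0 <= SV w)%R by exact: sumr_ge0.
have EV : \int[P]_w (SV w)%:E <= C0%:E.
  under eq_integral do rewrite -sumEFin.
  rewrite ge0_integral_sum//; last 2 first.
  - by move=> j; exact/measurable_EFinP.
  - by move=> j w _; rewrite lee_fin.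
  rewrite /C0 -sumEFin; apply: lee_sum => j _; rewrite /V.
  case jr : (I j); last by rewrite integral0.
  under eq_integral do rewrite EFinM.
  rewrite ge0_integralZl_EFin ?c0//.
  - by rewrite EFinM lee_wpmul2l ?lee_fin ?c0 ?EZ.
  - by move=> w _; rewrite lee_fin ZZ0.
  - by apply/measurable_EFinP; apply: measurable_funD => //; exact: mZ.
have C00 : (0 <= C0)%R.
  by apply: sumr_ge0 => j _; case: ifP => // jr; rewrite mulr_ge0 ?c0.
have VE w : SV w = (C0 + \sum_(j <- r | Q j) c j * Z j w)%R.
  rewrite big_seq_cond big_mkcond/= -big_split/=; apply: eq_bigr => j _.
  by rewrite /V /I; case: ifP => _; rewrite ?addr0// mulrDr addrC.
have main : \int[P]_w (u w)%:E + C0%:E <=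
    (A%:E * \int[P]_w (delta w)%:E + B%:E) + \int[P]_w (SV w)%:E.
  have muE : measurable_fun setT (fun w => (u w)%:E) by exact/measurable_EFinP.
  have mdE : measurable_fun setT (fun w => (delta w)%:E) by exact/measurable_EFinP.
  have mSVE : measurable_fun setT (fun w => (SV w)%:E) by exact/measurable_EFinP.
  have mAd : measurable_fun setT (fun w => A%:E * (delta w)%:E).
    by apply/measurable_EFinP; exact: measurable_funM.
  have mAdB : measurable_fun setT (fun w => A%:E * (delta w)%:E + B%:E).
    exact: emeasurable_funD.
  have Ad0 w : 0 <= A%:E * (delta w)%:E by rewrite mule_ge0// lee_fin.
  have AdB0 w : 0 <= A%:E * (delta w)%:E + B%:E by rewrite adde_ge0// lee_fin.
  have I1 : \int[P]_w ((u w)%:E + C0%:E) = \int[P]_w (u w)%:E + C0%:E.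
    rewrite ge0_integralD//; last by move=> w _; rewrite lee_fin.
    by congr (_ + _); exact: int_cst.
  have I2 : \int[P]_w (A%:E * (delta w)%:E) = A%:E * \int[P]_w (delta w)%:E.
    by rewrite ge0_integralZl_EFin// => w _; rewrite lee_fin.
  have I3 : \int[P]_w (A%:E * (delta w)%:E + B%:E) =
      A%:E * \int[P]_w (delta w)%:E + B%:E.
    by rewrite ge0_integralD// I2; congr (_ + _); exact: int_cst.
  have I4 : \int[P]_w (A%:E * (delta w)%:E + B%:E + (SV w)%:E) =
      A%:E * \int[P]_w (delta w)%:E + B%:E + \int[P]_w (SV w)%:E.
    by rewrite ge0_integralD// ?I3// => w _; rewrite lee_fin.
  rewrite -I1 -I4; apply: ge0_le_integral => //.
  - by move=> w _; rewrite adde_ge0 ?lee_fin.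
  - exact: emeasurable_funD.
  - exact: emeasurable_funD.
  - by move=> w _; rewrite -EFinM -!EFinD lee_fin VE; have := hu w; lra.
have := le_trans main (leeD2l _ EV).
by rewrite leeD2rE.
Qed.

End Expectation.

(** * The theorem *)

Theorem theorem1 (R : realType) (d : nat) (Xi : finType)
  (disp : measure_display) (Omega : measurableType disp)
  (P : probability Omega R)
  (* the transition matrix, its stationary distribution, the mixing constant *)
  (T : Xi -> Xi -> R) (pi : Xi -> R) (C : R)
  (hT : stochastic T) (hirr : irreducible_chain T) (haper : aperiodic_chain T)
  (hpi : stationary T pi) (hC : mixing_constant T pi C)
  (* the objective *)
  (F : 'rV[R]_d -> Xi -> R) (G : 'rV[R]_d -> Xi -> 'rV[R]_d)
  (f : 'rV[R]_d -> R)
  (hF : forall s, has_lbound (range (fun x => F x s)))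
  (hG : forall x s, is_gradient (fun z => F z s) x (G x s))
  (hf : f = mean_obj pi F)
  (* assumptions (i), (ii), (iii) *)
  (fstar L M : R)
  (hfinite : has_lbound (range f)) (hfstar : fstar = inf (range f))
  (hL : 0 < L)
  (hLf : forall x z,
     enorm (gradient f x - gradient f z) <= L * enorm (x - z))
  (hLG : forall x z s, enorm (G x s - G z s) <= L * enorm (x - z))
  (hM : 0 < M)
  (hMfG : forall x s, Num.max (enorm (gradient f x)) (enorm (G x s)) <= M)
  (* the step sizes *)
  (K : nat) (hK : (0 < K)%N)
  (hKL : 1 / Num.sqrt K%:R <= 1 / (4 * L))
  (alpha beta gamma : nat -> R)
  (halpha : forall k, (1 <= k)%N -> alpha k = 2 / (k%:R + 1))
  (hbeta : forall k, (1 <= k)%N -> beta k = 1 / Num.sqrt K%:R)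
  (hgamma : forall k, (1 <= k)%N ->
     beta k <= gamma k <= (1 + alpha k) * beta k)
  (* the chain, the iterates and the random index *)
  (xi : nat -> Omega -> Xi) (x xb y : nat -> Omega -> 'rV[R]_d)
  (hx0 : random_vector (x 0%N)) (hxb0 : random_vector (xb 0%N))
  (hxi : markov_chain P (x 0%N) (xb 0%N) T xi)
  (halg : accelerated_mgd G alpha beta gamma xi K x xb y)
  (p : nat -> R)
  (hp : forall k, (1 <= k <= K)%N ->
     p k = gamma k * (1 - L * gamma k) /
           \sum_(1 <= j < K.+1) gamma j * (1 - L * gamma j))
  (rho : Omega -> nat)
  (hrho : random_index P (x 0%N) (xb 0%N) xi K p rho) :
  ('E_P[fun w => (enorm (gradient f (y (rho w) w)) ^+ 2)%R]
   <= (2 * (4 * L + Num.sqrt K%:R) / K%:R)%:E *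
        ('E_P[fun w => f (x 0%N w)] - fstar%:E)
      + (2 * M * (L * M * (11 + 16 * C * ln K%:R) + 2) / Num.sqrt K%:R)%:E)%E.
Proof.
have K0 : 0 < (K%:R : R) by rewrite ltr0n.
have sK0 : 0 < Num.sqrt (K%:R : R) by rewrite sqrtr_gt0.
pose b : R := 1 / Num.sqrt K%:R.
have b0 : 0 < b by rewrite divr_gt0.
have bs : b * Num.sqrt K%:R = 1 by rewrite /b divfK ?gt_eqF.
have b2K : b ^+ 2 * K%:R = 1.
  by rewrite -[X in _ * X](sqr_sqrtr (ltW K0)) -exprMn bs expr1n.
have Kinv : (K%:R : R)^-1 = b ^+ 2.
  by apply: (mulIf (lt0r_neq0 K0)); rewrite mulVf ?gt_eqF.
have Lb : L * b <= 1 / 4.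
  move: hKL; rewrite -/b => /(ler_wpM2l (ltW hL)) /le_trans; apply.
  by rewrite le_eqVlt; apply/orP; left; apply/eqP; field; rewrite gt_eqF.
have [pi_dist _] := hpi.
have gradf z : is_gradient f z (\sum_s pi s *: G z s).
  by rewrite hf; exact: is_gradient_mean_obj.
have df z : differentiable f z := (gradf z).1.
have gM z : enorm (gradient f z) <= M.
  (* The joint bound needs some state, and [xi 0] at any outcome supplies one. *)
  by apply: le_trans (hMfG z (xi 0%N point)); rewrite le_max lexx.
have GM z s : enorm (G z s) <= M.
  by apply: le_trans (hMfG z s); rewrite le_max lexx orbT.
have f_ge z : fstar <= f z by rewrite hfstar; apply: ge_inf => //; exists z.
have lnK : 0 <= C * ln (K%:R : R).
  by rewrite mulr_ge0 ?ln_ge0 ?ler1n//; exact: ltW hC.1.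
(* [q.+1] exceeds the mixing time for accuracy [1 / K], while [q] itself stays below it. *)
pose q := Num.truncn (C * ln (K%:R : R)).
have qle : q%:R <= C * ln (K%:R : R) by rewrite truncn_le.
have tvq s : tv_dist (kstep T q.+1 s) pi <= 1 / K%:R.
  apply: hC.2; first exact: divr_gt0.
  by rewrite /mixing_time !div1r invrK ltW// truncnS_gt.
have Lip_cont (H : 'rV[R]_d -> 'rV[R]_d) i :
    (forall z w, enorm (H z - H w) <= L * enorm (z - w)) ->
    continuous (fun z => H z 0 i).
  move=> lip; apply: (lipschitz_enorm_continuous (ltW hL)) => z w.
  apply: le_trans (lip z w); have := coord_le_enorm (H z - H w) i.
  by rewrite !mxE.
have cG s i : continuous (fun z => G z s 0 i) by apply: Lip_cont => z w; exact: hLG.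
have cg i : continuous (fun z => gradient f z 0 i) by exact: Lip_cont.
have cn : continuous (fun z => enorm (gradient f z)).
  apply: (lipschitz_enorm_continuous (ltW hL)) => z w.
  apply: le_trans (hLf z w); rewrite ler_distl.
  have := enormD (gradient f z - gradient f w) (gradient f w).
  have := enormD (gradient f w - gradient f z) (gradient f z).
  by rewrite !subrK [enorm (gradient f w - _)]enormB => h1 h2; apply/andP; split; lra.
have cf : continuous f by move=> z; exact: differentiable_continuous.
have mf : measurable_fun setT (fun w => f (x 0%N w)).
  exact: (measurable_continuous_comp hx0 cf).
pose Z j w := lagged_bias f G M K (fun k => xi k w) (fun k => y k w) q j.
(* The inner product and the mixing correction in a lagged bias are each at least [- 2 M^2]. *)
pose Z0 : R := 4 * M ^+ 2.
(* The lagged bias with the sampled state [t] as a free argument, so that the history and the sample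
   can be separated. *)
pose hb (j : nat) t w := dotp (gradient f (y (j - q)%N w))
    (gradient f (y (j - q)%N w) - G (y (j - q)%N w) t)
  - 2 * M / K%:R * enorm (gradient f (y (j - q)%N w)).
have hb0 j t w : 0 <= hb j t w + Z0.
  rewrite /hb; set u := gradient f _; set v := G _ _.
  have h1 : - dotp u (u - v) <= M * (2 * M).
    rewrite -dotpNl; apply: le_trans (dotp_le _ _) _; rewrite enormN.
    apply: ler_pM; rewrite ?enorm_ge0 ?gM//.
    apply: le_trans (enormD _ _) _; rewrite enormN mulr_natl mulr2n.
    by rewrite lerD ?gM ?GM.
  have h2 : 2 * M / K%:R * enorm u <= 2 * M * M.
    apply: ler_pM; rewrite ?enorm_ge0 ?gM//; first by nneg.
    rewrite ler_pdivrMr// ler_peMr ?ler1n//; nneg.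
  rewrite /Z0; lra.
have mhb (J : set nat) j t : (q < j <= K)%N -> (forall i, (1 <= i < j - q)%N -> J i) ->
    measurable_fun [set: g_sigma_algebraType
      (coord_events (x 0%N) `|` coord_events (xb 0%N) `|`
      [set A | exists (j : nat) (s : Xi), J j /\ A = [set w | xi j w = s]])] (hb j t).
  move=> /andP[qj jK] Jj.
  have jq : (1 <= j - q <= K)%N.
    by rewrite subn_gt0 qj (leq_trans (leq_subr _ _)).
  have my := query_measurable cG erefl erefl halg jq Jj.
  rewrite /hb; apply: measurable_funB; last first.
    apply: measurable_funM => //; exact: (measurable_continuous_comp my cn).
  apply: measurable_sum => i; apply: measurable_funM.
    exact: (measurable_continuous_comp my (cg i)).
  rewrite (_ : (fun _ => _) = fun w =>
      gradient f (y (j - q)%N w) 0 i - G (y (j - q)%N w) t 0 i).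
    apply: measurable_funB; first exact: (measurable_continuous_comp my (cg i)).
    exact: (measurable_continuous_comp my (@cG t i)).
  by apply/funext => w; rewrite !mxE.
have mnorm k : (1 <= k <= K)%N ->
    measurable_fun [set: g_sigma_algebraType
      (coord_events (x 0%N) `|` coord_events (xb 0%N) `|`
      [set A | exists (j : nat) (s : Xi), setT j /\ A = [set w | xi j w = s]])]
    (fun w => enorm (gradient f (y k w)) ^+ 2).
  move=> kK; apply: measurable_funX.
  have my := query_measurable cG erefl erefl halg kK (fun _ _ => I).
  exact: (measurable_continuous_comp my cn).
have EZ j : (q < j <= K)%N -> (\int[P]_w (Z j w + Z0)%:E <= Z0%:E)%E.
  move=> /andP[qj jK].
  (* [y (j - q)] uses samples up to time [j - q.+1] only, which leaves [q.+1] transitions before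
     [xi j]. *)
  have jE : (j - q.+1 + q.+1)%N = j by rewrite subnK.
  have := @markov_integral_le _ _ _ _ _ P _ _ T xi hx0 hxb0 hxi hT q.+1 (j - q.+1)%N
    (fun t w => hb j t w + Z0) Z0.
  rewrite jE; apply => //.
    move=> t; apply: measurable_funD => //; apply: mhb; first by rewrite qj.
    by move=> i /andP[_]; rewrite /= subnS; case: (j - q)%N.
  move=> s w; rewrite /hb.
  set z := y _ w.
  have kd : is_dist (kstep T q.+1 s).
    by split=> [t|]; [exact: kstep_ge0 | exact: kstep_sum1].
  have := mixed_bias_le kd pi_dist (esym (gradf z).2) (GM z) (ltW hM) (tvq s).
  set e := enorm _ => h; set c := 2 * M / K%:R * e.
  have -> : \sum_t kstep T q.+1 s t *
        (dotp (gradient f z) (gradient f z - G z t) - c + Z0) =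
      \sum_t kstep T q.+1 s t * dotp (gradient f z) (gradient f z - G z t)
      - (c - Z0).
    rewrite -[X in _ - X]mul1r -(kstep_sum1 q.+1 s hT) mulr_suml -sumrB.
    by apply: eq_bigr => t _; ring.
  by rewrite opprB addrCA gerDl subr_le0 (le_trans h)// /c div1r.
have hgamma' k : (1 <= k)%N -> b <= gamma k <= (1 + alpha k) * b.
  by move=> k1; have := hgamma k k1; rewrite hbeta.
have bound w : \sum_(1 <= k < K.+1) p k * enorm (gradient f (y k w)) ^+ 2 <=
  (8 * L * b ^+ 2 + 2 * b) * (f (x 0%N w) - fstar)
  + b * (L * M ^+ 2 * (22 + 32 * q%:R))
  + \sum_(1 <= j < K.+1 | (q < j)%N) lag_coef L K b gamma p j * Z j w.
  apply: (weighted_bound hL hM df f_ge hLf hLG gM GM b0 b2K Lb halpha hgamma'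
    (s := fun k => xi k w) (x := fun k => x k w) (xb := fun k => xb k w)
    (y := fun k => y k w)) => // k kK.
  - by have [-> _ _] := halg k w kK.
  - by have [_ -> _] := halg k w kK.
  - have [_ _ ->] := halg k w kK; rewrite hbeta//; by case/andP: kK.
have p0 := prob_ge0 hL b0 b2K Lb halpha hgamma' hK hp.
have cge := lag_coef_ge0 hL b0 b2K Lb halpha hgamma' hK hp.
(* The index is averaged out first, which brings the expectation into the form of the pathwise
   bound. *)
rewrite unlock (random_index_integral hx0 hxb0 hxi hrho p0
  (u := fun k w => enorm (gradient f (y k w)) ^+ 2) mnorm)//; last first.
  by move=> k w; exact: sqr_ge0.
have jK j : (j \in index_iota 1 K.+1) && (q < j)%N -> (q < j <= K)%N.
  by rewrite mem_index_iota => /andP[/andP[_ jK] ->].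
have mZ j : (q < j <= K)%N -> measurable_fun setT (Z j).
  move=> qjK; apply: (@measurable_fun_cases _ _ _ _ (xi j) (hb j)); first exact: hxi.1.
  move=> t; apply: (history_measurable_fun hx0 hxb0 hxi (J := setT)).
  exact: mhb.
have mu : measurable_fun setT (fun w =>
    \sum_(1 <= k < K.+1) p k * enorm (gradient f (y k w)) ^+ 2).
  under eq_fun do rewrite big_add1 big_mkord.
  apply: measurable_sum => k; apply: measurable_funM => //.
  apply: (history_measurable_fun hx0 hxb0 hxi (J := setT)).
  by apply: mnorm; rewrite /= ltn_ord.
have B0 : 0 <= b * (L * M ^+ 2 * (22 + 32 * q%:R)) by nneg.
have A0 : 0 <= 8 * L * b ^+ 2 + 2 * b by nneg.
have drift := integral_le_of_drift (P := P) (r := index_iota 1 K.+1)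
  (Q := fun j => (q < j)%N) (delta := fun w => f (x 0%N w) - fstar) (Z0 := Z0)
  (c := lag_coef L K b gamma p) (Z := Z)
  mu _ _ _ _ A0 B0 _ _ _ _ bound.
apply: (le_trans (drift _ _ _ _ _ _ _ _)).
- exact: measurable_funB.
- by move=> j /jK; exact: mZ.
- by move=> w; rewrite big_nat; apply: sumr_ge0 => k kK; rewrite mulr_ge0 ?sqr_ge0 ?p0.
- by move=> w; rewrite subr_ge0.
- by rewrite /Z0; nneg.
- by move=> j /jK /andP[qj _]; apply: cge; exact: leq_trans qj.
- by move=> j w _; exact: hb0.
- by move=> j /jK; exact: EZ.
rewrite (integral_sub_lbound _ mf (fun w => f_ge _)).
have -> : 8 * L * b ^+ 2 + 2 * b = 2 * (4 * L + Num.sqrt K%:R) / K%:R.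
  rewrite Kinv [LHS](_ : _ = 8 * L * b ^+ 2 + 2 * b * (b * Num.sqrt K%:R)); first by ring.
  by rewrite bs mulr1.
apply: leeD2l; rewrite lee_fin.
(* Against the pathwise constant, the right side has [C * ln K%:R] in place of its floor [q], plus a
   nonnegative term. *)
rewrite [leRHS](_ : _ = b * (L * M ^+ 2 * (22 + 32 * (C * ln K%:R)) + 4 * M)); last first.
  by rewrite -[_ / Num.sqrt _]mulr1 /b; field; rewrite gt_eqF.
rewrite ler_wpM2l ?(ltW b0)//; apply: ler_wpDr; first by nneg.
rewrite ler_wpM2l//; first by nneg.
by rewrite lerD2l ler_wpM2l.
Qed.
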